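(* Let $n,k\geq 1$. For any permutation $\tau$, the peak set is equidistributed over $\mathcal{S}_n(I_k\oplus\tau)$ and $\mathcal{S}_n(J_k\oplus\tau)$; that is, for every set $A$ of positive integers, the number of $\pi\in\mathcal{S}_n(I_k\oplus\tau)$ with $\mathrm{Peak}(\pi)=A$ equals the number of $\pi\in\mathcal{S}_n(J_k\oplus\tau)$ with $\mathrm{Peak}(\pi)=A$.
   Context: $\mathcal{S}_n$ is the set of permutations of $\{1,\ldots,n\}$, written as words $\pi=\pi_1\pi_2\cdots\pi_n$. An index $i$ with $2\le i\le n-1$ is a peak of $\pi$ if $\pi_{i-1}<\pi_i>\pi_{i+1}$; $\mathrm{Peak}(\pi)$ is the set of peaks of $\pi$. A permutation $\pi$ contains a pattern $\sigma\in\mathcal{S}_m$ if some subsequence of $\pi$ of length $m$ is order isomorphic to $\sigma$; otherwise $\pi$ avoids $\sigma$. $\mathcal{S}_n(\sigma)$ is the set of $\sigma$-avoiding permutations in $\mathcal{S}_n$. $I_k=12\cdots k$ and $J_k=k\cdots 21$. For $\pi\in\mathcal{S}_a$ and $\sigma\in\mathcal{S}_b$, the direct sum is $\pi\oplus\sigma=\pi_1\cdots\pi_a(\sigma_1+a)\cdots(\sigma_b+a)$; for the empty permutation $\epsilon$, $\pi\oplus\epsilon=\pi$. *)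

(* Defs.v *)
From mathcomp Require Import all_boot all_fingroup.
From mathcomp Require Import boolp classical_sets.

Set Implicit Arguments.
Unset Strict Implicit.
Unset Printing Implicit Defensive.

(* Elements of 'S_n permute {0, ..., n-1}; [word] and [letter] translate to   *)
(* the usual one-line notation pi_1 ... pi_n with positions and values in     *)
(* {1, ..., n}; [letter pi i] is pi_i and is only meaningful for 1 <= i <= n. *)
Definition word n (pi : 'S_n) : seq nat := [seq (pi i).+1 | i : 'I_n].

Definition letter n (pi : 'S_n) (i : nat) : nat := nth 0 (word pi) i.-1.

Definition peak n (pi : 'S_n) : set nat :=
  [set i | [/\ 2 <= i, i <= n - 1,
               letter pi (i - 1) < letter pi i
             & letter pi i > letter pi (i + 1)]]%classic.

Definition contains n m (pi : 'S_n) (sigma : 'S_m) : bool :=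
  [exists f : {ffun 'I_m -> 'I_n},
     [forall i : 'I_m, forall j : 'I_m, (i < j) ==> (f i < f j)] &&
     [forall i : 'I_m, forall j : 'I_m, (sigma i < sigma j) == (pi (f i) < pi (f j))]].

Definition avoiders n m (sigma : 'S_m) : {set 'S_n} :=
  [set pi : 'S_n | ~~ contains pi sigma]%SET.

Definition incr_perm k : 'S_k := 1%g.

Definition decr_perm k : 'S_k := perm (@rev_ord_inj k).

Section DirectSum.
Variables (a b : nat) (pi : 'S_a) (sigma : 'S_b).

Definition dsum_fun (i : 'I_(a + b)) : 'I_(a + b) :=
  match split i with
  | inl j => lshift b (pi j)
  | inr j => rshift a (sigma j)
  end.

Lemma dsum_fun_inj : injective dsum_fun.
Proof.
move=> i j; rewrite /dsum_fun.
case: (split_ordP i) => i' ->; case: (split_ordP j) => j' ->.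
- by move=> /lshift_inj /perm_inj ->.
- by move=> /eqP; rewrite eq_lrshift.
- by move=> /eqP; rewrite eq_rlshift.
- by move=> /rshift_inj /perm_inj ->.
Qed.

Definition dsum : 'S_(a + b) := perm dsum_fun_inj.
End DirectSum.

(* Main.v *)
(** A cell (i, j) of the permutation matrix of pi is inside if a copy of tau lies
strictly north-east of it.  The inside cells form a Young diagram, pi contains
I_k (+) tau (resp. J_k (+) tau) iff the points of pi in this diagram contain an
increasing (resp. decreasing) chain of length k whose bounding corner is in the
diagram, and rearranging these points inside the diagram does not change the
diagram.  A point inside next_states to a point outside is always the smaller of the two,
and adjacent columns with both points inside have equal heights; so, with the
outside points fixed, only the peaks inside blocks of columns of equal height vary.

Reading the rows from bottom to top and removing the columns of the diagram from
the right as soon as they are complete, RSK insertion turns the fillings of the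
diagram into closed walks in Young's lattice: a row adds a cell, a column removes
one.  By Schensted's theorem, avoiding I_k (resp. J_k) bounds the length of the
first row (resp. column) of the shapes along the walk, and the walk ascends at a
pair of columns iff the two removed cells form a horizontal strip.  A block of
columns without inner peak is a vertical strip followed by a horizontal strip; the
number of such decompositions of a skew shape is 0 or a power of 2 that is
invariant under transposition.  Transposing the shapes thus matches the fillings
that avoid I_k with those that avoid J_k, when peaks are only allowed at the
elements of E and E + 1 for a set of positions E.  These counts determine the
distribution of the peak set by triangularity, since peak sets are sparse. *)

Require Import Defs.
From mathcomp Require Import all_boot all_fingroup.
From mathcomp Require Import zify.
From mathcomp Require Import boolp.

Set Implicit Arguments.
Unset Strict Implicit.
Unset Printing Implicit Defensive.

(** * Row insertion on lattice words *)

(** The obstacle is that transposing a walk exchanges ascents and descents, hence peaks and valleys,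
    so a filling cannot simply be matched with the filling of the transposed walk. What survives is
    a number: between two shapes there are as many blocks that descend and then ascend as between
    the transposed shapes. This supports only conditions that forbid peaks on runs of columns.
    Separating the columns [i] and [i+1] releases the two possible peaks [i] and [i+1] together,
    which is the origin of E and E + 1. A standard tableau is stored as the word of the row indices
    of its columns: discarding the last columns is then truncation, and the predecessors of a state
    under insertion are found by reverse insertion from the corners of its shape. The number of
    walks thus becomes an expression in shapes alone, which can be transposed without any
    correspondence between words. *)

(* A tableau under construction is a word [s : seq (option nat)]: the entry
   [Some i] at index [x] means that column [x] lies in row [i] of the insertion
   tableau, and [None] that column [x] is not used yet.  Inserting a column
   promotes the first later entry of row 0 to row 1, then the first entry of
   row 1 after that one to row 2, and so on. *)
Fixpoint bump (k : nat) (s : seq (option nat)) :=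
  if s is a :: s' then
    if a == Some k then Some k.+1 :: bump k.+1 s' else a :: bump k s'
  else [::].

Fixpoint final_row (k : nat) (s : seq (option nat)) : nat :=
  if s is a :: s' then final_row (if a == Some k then k.+1 else k) s' else k.

Fixpoint ins x (s : seq (option nat)) {struct s} :=
  if s is a :: s' then
    if x is x'.+1 then a :: ins x' s' else Some 0 :: bump 0 s'
  else [::].

Definition ins_row x (s : seq (option nat)) : nat := final_row 0 (drop x.+1 s).

Definition cnt (i : nat) (s : seq (option nat)) : nat := count_mem (Some i) s.
Arguments cnt : simpl never.

(** The Yamanouchi condition: in every prefix the row lengths form a partition. So [s] encodes a
    standard tableau on its used columns, and truncation removes the largest entries. *)
Definition lattice s := forall q i, cnt i.+1 (take q s) <= cnt i (take q s).

(* The first component is [None] iff the scan from the right has met the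
   inserted column. *)
Fixpoint unins (i : nat) (s : seq (option nat)) : option nat * seq (option nat) :=
  if s is a :: s' then
    let: (o, z) := unins i s' in
    if o is Some k then
      if a == Some k then
        if k is k'.+1 then (Some k', Some k' :: z) else (None, None :: z)
      else (Some k, a :: z)
    else (None, a :: z)
  else (Some i, [::]).

Lemma size_bump k s : size (bump k s) = size s.
Proof. by elim: s k => //= a s IH k; case: ifP => _ /=; rewrite IH. Qed.

Lemma size_ins x s : size (ins x s) = size s.
Proof. by elim: s x => //= a s IH [|x] /=; rewrite ?IH ?size_bump. Qed.

Lemma take_bump q k s : take q (bump k s) = bump k (take q s).
Proof. by elim: s k q => //= a s IH k [|q]; rewrite ?take0 //=; case: ifP => _ /=; rewrite IH. Qed.

(** Bumping only moves to the right, so the columns below [q] never depend on the later ones. This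
    is what allows columns to be discarded early at the right end. *)
Lemma take_ins_lt q x s : x < q -> take q (ins x s) = ins x (take q s).
Proof.
elim: s x q => //= a s IH [|x] [|q] //=; first by rewrite take_bump.
by move=> lt_xq; rewrite IH.
Qed.

Lemma take_ins_ge q x s : q <= x -> take q (ins x s) = take q s.
Proof. by elim: s x q => //= a s IH [|x] [|q] //= le_qx; rewrite IH. Qed.

Lemma eq_Some (i j : nat) : (Some i == Some j) = (i == j).
Proof. by []. Qed.

Lemma cnt_cons i a s : cnt i (a :: s) = (a == Some i) + cnt i s.
Proof. by []. Qed.

Lemma cnt_bump i k s :
  cnt i (bump k s) + (i == k) = cnt i s + (i == final_row k s).
Proof.
elim: s k => [|a s IH] k //=; case: eqP => [->|/eqP nak] /=.
  have := IH k.+1; rewrite !cnt_cons !eq_Some; lia.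
by have := IH k; rewrite !cnt_cons; lia.
Qed.

(** The default [Some 0] makes the hypothesis also say that [x] is a column of [s]. *)
Lemma cnt_ins i x s : nth (Some 0) s x = None ->
  cnt i (ins x s) = cnt i s + (i == ins_row x s).
Proof.
elim: s x => [|a s IH] [|x] //=.
  move=> ->; rewrite /ins_row /= drop0 !cnt_cons eq_Some.
  move: (cnt_bump i 0 s) => H; rewrite add0n. by lia.
by move=> /IH; rewrite !cnt_cons /ins_row /= => ->; rewrite addnA.
Qed.

Lemma unins_bump k s : unins (final_row k s) (bump k s) = (Some k, s).
Proof.
elim: s k => [|a s IH] k //=; case: eqP => [->|/eqP nak] /=; rewrite IH ?eqxx //.
by rewrite (negPf nak).
Qed.

Lemma unins_ins x s : nth (Some 0) s x = None ->
  unins (ins_row x s) (ins x s) = (None, s).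
Proof.
elim: s x => [|a s IH] [|x] //=; last by rewrite /ins_row /= => /IH ->.
by move=> ->; rewrite /ins_row /= drop0 unins_bump.
Qed.

Lemma unins_Some i s k z : unins i s = (Some k, z) ->
  bump k z = s /\ final_row k z = i.
Proof.
elim: s k z => [|a s IH] k z /=; first by case=> <- <-.
case E: (unins i s) => [[j|] z'] //; have [IH1 IH2] := IH _ _ E.
case: eqP => [->|/eqP naj].
  by case: j E IH1 IH2 => // j E IH1 IH2 [<- <-] /=; rewrite eqxx IH1 IH2.
by case=> <- <- /=; rewrite (negPf naj) IH1 IH2.
Qed.

Lemma unins_None i s z : unins i s = (None, z) ->
  exists x, [/\ x < size z, nth (Some 0) z x = None, ins x z = s & ins_row x z = i].
Proof.
elim: s z => [|a s IH] z //=.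
case E: (unins i s) => [[j|] z'].
  have [U1 U2] := unins_Some E.
  case: eqP => [->|//]; case: j E U1 U2 => // E U1 U2 [<-].
  by exists 0; split => //=; rewrite ?U1 // /ins_row /= drop0.
case=> <-; have [x [x1 x2 x3 x4]] := IH _ E.
by exists x.+1; split => //=; rewrite x3.
Qed.

Lemma size_unins i s : size (unins i s).2 = size s.
Proof.
elim: s => //= a s; case: (unins i s) => [[j|] z] //=; last by move=> ->.
by case: ifP => _; case: j => [|j] /= ->.
Qed.

Lemma ins_inj_pos x x' s : x < size s -> x' < size s ->
  nth (Some 0) s x = None -> nth (Some 0) s x' = None ->
  ins x s = ins x' s -> x = x'.
Proof.
elim: s x x' => [|a s IH] [|x] [|x'] //=.
- by move=> _ _ ->.
- by move=> _ _ _ ->.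
- by move=> lx lx' Nx Nx' [] /IH ->.
Qed.

Lemma lattice_take q s : lattice s -> lattice (take q s).
Proof.
by move=> ls p i; rewrite -!take_min; apply: ls.
Qed.

Lemma lattice_rcons s a : lattice (rcons s a) <->
  lattice s /\ (forall i, cnt i.+1 (rcons s a) <= cnt i (rcons s a)).
Proof.
split=> [l|[ls la] q i].
  split=> [q i|i]; last by have := l (size s).+1 i; rewrite take_oversize ?size_rcons.
  have [le_q|lt_q] := leqP q (size s).
    by have := l q i; rewrite -cats1 takel_cat.
  rewrite take_oversize ?(ltnW lt_q) //.
  by have := l (size s) i; rewrite -cats1 take_size_cat.
have [le_q|lt_q] := leqP q (size s); first by rewrite -cats1 takel_cat //.
by rewrite take_oversize ?size_rcons.
Qed.

Lemma lattice_nseq N : lattice (nseq N None).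
Proof.
have cntN q i : cnt i (nseq q None) = 0 by rewrite /cnt count_nseq.
move=> q i; have [le_q|lt_q] := leqP q N; first by rewrite take_nseq // !cntN.
by rewrite take_oversize ?size_nseq ?(ltnW lt_q) // !cntN.
Qed.

Lemma final_row_rcons k s a :
  final_row k (rcons s a) =
  if a == Some (final_row k s) then (final_row k s).+1 else final_row k s.
Proof. by elim: s k => [|b s IH] k //=. Qed.

(* Since the claim is about all prefixes and insertion commutes with taking
   prefixes, only the full counts have to be compared. *)
Lemma lattice_ins x s : nth (Some 0) s x = None -> lattice s -> lattice (ins x s).
Proof.
move=> Nx; elim/last_ind: s Nx => [|s a IH] Nx // => /lattice_rcons [ls la].
have [lt_x|ge_x] := ltnP x (size s).
  move: Nx; rewrite nth_rcons lt_x => Nx.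
  have E : take (size s) (ins x (rcons s a)) = ins x s.
    by rewrite take_ins_lt // -cats1 take_size_cat.
  have sz: size (ins x (rcons s a)) = (size s).+1 by rewrite size_ins size_rcons.
  move: (IH Nx ls) => lI q i.
  have [le_q|lt_q] := leqP q (size s).
    have := lI q i; rewrite -E take_takel //.
  rewrite take_oversize ?sz // !cnt_ins ?nth_rcons ?lt_x //.
  have := lI (size s) i; rewrite take_oversize ?size_ins // !cnt_ins //.
  have -> : ins_row x (rcons s a) =
    if a == Some (ins_row x s) then (ins_row x s).+1 else ins_row x s.
    by rewrite /ins_row drop_rcons ?final_row_rcons.
  have := la i; rewrite -!cats1 /cnt !count_cat /= !addn0.
  set r := ins_row x s; have := ls (size s) i; rewrite take_size /cnt.
  case: (a =P Some r) => [->|/eqP nar].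
    rewrite !eq_Some; clear -i; move: (count_mem (Some i.+1) s) (count_mem (Some i) s) r => c1 c2 r; lia.
  case: (a =P Some i.+1) => [Ea|_]; case: (a =P Some i) => [Eb|_]; try lia.
  by move: nar; rewrite Ea eq_Some; lia.
move=> q i; case: (leqP q x) => [le_q|lt_q].
  rewrite take_ins_ge // -cats1.
  have [lq|lq] := leqP q (size s); first by rewrite takel_cat.
  rewrite take_oversize; last by rewrite size_cat addn1.
  by have := la i; rewrite cats1.
move: Nx; rewrite nth_rcons ltnNge ge_x /=; case: eqP => // Ex Na.
rewrite take_oversize; last by rewrite size_ins size_rcons -Ex.
rewrite !cnt_ins ?nth_rcons ?Ex ?ltnn ?eqxx // /ins_row drop_oversize ?size_rcons //=.
by have := la i; rewrite /= ; lia.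
Qed.

Definition removable i s := cnt i.+1 s < cnt i s.

Lemma unins_rcons i s a : unins i (rcons s a) =
  if a == Some i then
    if i is i'.+1 then ((unins i' s).1, rcons (unins i' s).2 (Some i'))
    else (None, rcons s None)
  else ((unins i s).1, rcons (unins i s).2 a).
Proof.
elim: s => [|b s IH] /=; first by case: eqP => // _; case: i.
rewrite IH; case: eqP => [_|/eqP nai].
  by case: i {IH} => // i; case: (unins i s) => [[j|] z] //=; case: ifP => // _; case: j.
by case: (unins i s) => [[j|] z] //=; case: ifP => // _; case: j.
Qed.

(** Peel off the last letter. If it is [Some i.+1] and row [i.+1] is being undone, the lattice
    condition at this letter leaves row [i] longer than row [i.+1] in the shorter word, so the
    reversal again starts from a corner; any other letter keeps the row removable. *)
Lemma unins_lattice i s : lattice s -> removable i s ->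
  (unins i s).1 = None /\ lattice (unins i s).2.
Proof.
elim/last_ind: s i => [|s a IH] i //.
move=> /lattice_rcons [ls la] ri; rewrite unins_rcons.
have cnt_rcons t b j : cnt j (rcons t b) = cnt j t + (b == Some j).
  by rewrite -cats1 /cnt count_cat /= addn0.
have cntU j r z : unins r s = (None, z) -> cnt j s = cnt j z + (j == r).
  by case/unins_None => x [lx Nx <- <-]; apply: cnt_ins.
case: eqP ri la => [->|/eqP nai] ri la.
  case: i ri la => [|i] ri la /=.
    split=> //; apply/lattice_rcons; split=> // j; rewrite !cnt_rcons !addn0.
    by have := ls (size s) j; rewrite take_size.
  have ri' : removable i s.
    by have := la i; rewrite /removable !cnt_rcons !eq_Some; lia.
  have := IH _ ls ri'; case E: (unins i s) => [o z] /= [Eo lz]; subst o.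
  split=> //; apply/lattice_rcons; split=> // j.
  have := ls (size s) j; rewrite take_size !cnt_rcons !eq_Some.
  by rewrite !(cntU _ _ _ E); lia.
have ri' : removable i s.
  by move: ri; rewrite /removable !cnt_rcons (negPf nai) addn0; lia.
have := IH _ ls ri'; case E: (unins i s) => [o z] /= [Eo lz]; subst o.
split=> //; apply/lattice_rcons; split=> // j.
move: ri (la j) (ls (size s) j); rewrite /removable take_size !cnt_rcons.
rewrite !(cntU _ _ _ E) (negPf nai).
have [->|] := eqVneq j i; first by rewrite ?eqxx; lia.
by lia.
Qed.

Lemma cnt_unins i s j : (unins i s).1 = None ->
  cnt j s = cnt j (unins i s).2 + (j == i).
Proof.
case E: (unins i s) => [o z] /= Eo; subst o.
by case/unins_None: E => x [lx Nx <- <-]; apply: cnt_ins.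
Qed.

(** * Longest increasing subsequences of lattice words *)

Fixpoint lis (b : nat) (s : seq (option nat)) : nat :=
  if s is a :: s' then
    if a is Some i then
      if b <= i then maxn (lis b s') (lis i.+1 s').+1 else lis b s'
    else lis b s'
  else 0.

Lemma lis_anti b b' s : b <= b' -> lis b' s <= lis b s.
Proof.
elim: s b b' => //= -[i|] s IH b b' le_b; last exact: IH.
have := IH _ _ le_b.
by case: (leqP b i); case: (leqP b' i); lia.
Qed.

Lemma lis_succ b s : lis b s <= (lis b.+1 s).+1.
Proof.
elim: s b => //= -[i|] s IH b; last exact: IH.
have [lt_bi|lt_ib|<-] := ltngtP b i; first by have := IH b; lia.
  by have := IH b; lia.
by have := IH b; lia.
Qed.

Lemma lis_bump_ge k s :
  (forall b, lis b s <= lis b (bump k s)) /\ lis k s <= lis k.+1 (bump k s).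
Proof.
elim: s k => //= -[i|] s IH k; last by case: (IH k).
have [[IH1 IH2]] := (IH k, IH k.+1).
case=> IH3 IH4; rewrite eq_Some; case: (i =P k) => [->|nik]; split.
- move=> b /=; have := IH3 b; case: (leqP b k) => [le_bk|lt_kb].
    by rewrite (leqW le_bk); lia.
  by case: (leqP b k.+1); lia.
- rewrite /= !leqnn; have := IH3 k.+1; have := lis_succ k s; lia.
- by move=> b /=; have := IH1 b; have := IH1 i.+1; case: (leqP b i); lia.
- by rewrite /=; have := IH1 i.+1; case: (leqP k i); case: (leqP k.+1 i); lia.
Qed.

(** Reason for the case [k < b]: in a chain of the bumped word let [j.+1] be the last promoted
    letter. Up to it the chain has at most [j.+2 - b] letters, which in [s] can be exchanged for the
    bumping path through the rows [k, ..., j], a gain of at least [b - k.+1]. A chain without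
    promoted letters already lies in [s]. *)
Lemma lis_bump_le k s :
  (forall b, b <= k -> lis b (bump k s) <= lis b s) /\
  (forall b, k < b ->
     lis b (bump k s) + (b - k.+1) <= maxn (lis b s + (b - k.+1)) (lis k s)).
Proof.
elim: s k => [|[i|] s IH] k /=; first by split=> // b; lia.
  have [[IH1 IH2]] := (IH k, IH k.+1).
  case=> IH3 IH4; rewrite eq_Some; case: (i =P k) => [->|nik]; split=> b lb /=.
  - rewrite lb (leqW lb); have := IH3 b (leqW lb); have := IH4 k.+2 (ltnSn _).
    have := @lis_anti k.+1 k.+2 s (leqnSn _); lia.
  - have := IH4 k.+2 (ltnSn _); have := @lis_anti k.+1 k.+2 s (leqnSn _).
    have := @lis_anti k k.+1 s (leqnSn _).
    case: (ltngtP k.+1 b) lb => // [lt_kb|<-] _; rewrite ?leqnn.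
      have := IH4 _ lt_kb; case: (leqP b k); case: (leqP b k.+1); lia.
    have := IH3 _ (leqnn k.+1); case: (leqP k.+1 k); lia.
  - have := IH1 _ lb; case: (leqP b i) => // le_bi.
    case: (leqP i.+1 k) => [lt_ik|le_ki]; first by have := IH1 _ lt_ik; lia.
    have := IH2 _ le_ki; have := @lis_anti b k s lb. lia.
  - have := IH2 _ lb; case: (leqP k i) => [le_ki|lt_ik].
      have := IH2 i.+1 le_ki; case: (leqP b i); lia.
    by case: (leqP b i); lia.
by case: (IH k).
Qed.

Lemma lis_insert b u s :
  lis b (u ++ Some 0 :: bump 0 s) + b <= maxn (lis b (u ++ None :: s) + b) (lis 0 s).+1.
Proof.
elim: u b => [|[i|] u IH] b /=; last exact: IH.
  have [le2 le3] := lis_bump_le 0 s.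
  case: (leqP b 0) => [|lt_0b]; last by have := le3 _ lt_0b; lia.
  rewrite leqn0 => /eqP->; have := le2 0 (leqnn _); have := le3 1 (ltnSn _).
  by have := @lis_anti 0 1 s isT; lia.
by have := IH b; have := IH i.+1; case: (leqP b i); lia.
Qed.

Lemma lis_insert_ge u s :
  maxn (lis 0 (u ++ None :: s)) (lis 0 s).+1 <= lis 0 (u ++ Some 0 :: bump 0 s).
Proof.
have [ge1 ge2] := lis_bump_ge 0 s.
have H b : lis b (u ++ None :: s) <= lis b (u ++ Some 0 :: bump 0 s).
  elim: u b => [|[i|] u IH] b /=; last exact: IH.
    by have := ge1 b; case: (leqP b 0); lia.
  by have := IH b; have := IH i.+1; case: (leqP b i); lia.
rewrite geq_max H /=; apply: leq_trans (_ : lis 0 (Some 0 :: bump 0 s) <= _).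
  by rewrite /=; lia.
move: (Some 0 :: _) => t; elim: u {H} => [|[i|] u IH] //=.
by rewrite leq_max IH.
Qed.

Lemma drop_ins_le a x s : a <= x -> drop a (ins x s) = ins (x - a) (drop a s).
Proof. by elim: s x a => [|b s IH] [|x] [|a] //= le_ax; rewrite IH. Qed.

Lemma insE x s : x < size s ->
  ins x s = take x s ++ Some 0 :: bump 0 (drop x.+1 s).
Proof. by elim: s x => [|b s IH] [|x] //= lt_x; rewrite ?drop0 // IH. Qed.

(** After the cut the word is again a bumped one, started at some row, and at [b = 0] the two bounds
    on bumping meet. *)
Lemma lis_drop_bump k a s : lis 0 (drop a (bump k s)) = lis 0 (drop a s).
Proof.
elim: s a k => [|b s IH] [|a] k; rewrite ?drop0 //; last first.
  by rewrite /=; case: ifP => _ /=; rewrite IH.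
apply/eqP; rewrite eqn_leq; have [ge _] := lis_bump_ge k (b :: s).
by have [le _] := lis_bump_le k (b :: s); rewrite ge le.
Qed.

(* The longest strictly increasing subsequence of the rows of the columns
   [>= a] changes under insertion exactly as the longest decreasing
   subsequence of the inserted word does. *)
Lemma lis_drop_ins a x s : x < size s -> nth (Some 0) s x = None ->
  lis 0 (drop a (ins x s)) =
  if a <= x then maxn (lis 0 (drop a s)) (lis 0 (drop x.+1 s)).+1
  else lis 0 (drop a s).
Proof.
move=> lt_x Nx; case: leqP => [le_ax|lt_xa].
  rewrite drop_ins_le // insE ?size_drop ?ltn_sub2r //; last first.
    by apply: leq_ltn_trans lt_x.
  have E : drop a s = take (x - a) (drop a s) ++ None :: drop (x - a).+1 (drop a s).
    rewrite -{1}(cat_take_drop (x - a) (drop a s)); congr (_ ++ _).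
    rewrite (drop_nth (Some 0)) ?size_drop ?ltn_sub2r //; last first.
      by apply: leq_ltn_trans lt_x.
    by rewrite nth_drop subnKC // Nx.
  rewrite drop_drop addSn subnK // in E *.
  have := lis_insert 0 (take (x - a) (drop a s)) (drop x.+1 s).
  have := lis_insert_ge (take (x - a) (drop a s)) (drop x.+1 s).
  by rewrite -E !addn0 => le1 le2; apply/eqP; rewrite eqn_leq le2.
rewrite insE // drop_cat size_take lt_x ltnNge (ltnW lt_xa) /=.
case E: (a - x) => [|c]; first by move: lt_xa; rewrite -subn_gt0 E.
by rewrite /= lis_drop_bump drop_drop -(subnK (ltnW lt_xa)) E addSnnS.
Qed.

Lemma lis_le_bound b k s : (forall i, k <= i -> cnt i s = 0) -> lis b s <= k - b.
Proof.
elim: s b => [|[i|] s IH] b Hk //=.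
  have Hs j : k <= j -> cnt j s = 0 by move/Hk; rewrite cnt_cons; lia.
  have lt_ik : i < k.
    by rewrite ltnNge; apply/negP => /Hk; rewrite cnt_cons eqxx.
  by have := IH b Hs; have := IH i.+1 Hs; case: (leqP b i); lia.
by apply: IH => j /Hk; rewrite cnt_cons.
Qed.

Lemma cnt_cat i s t : cnt i (s ++ t) = cnt i s + cnt i t.
Proof. exact: count_cat. Qed.

Lemma cnt_rcons i s a : cnt i (rcons s a) = cnt i s + (a == Some i).
Proof. by rewrite -cats1 cnt_cat /cnt /= addn0. Qed.

Lemma lattice_cnt s i j : lattice s -> i <= j -> cnt j s <= cnt i s.
Proof.
move=> ls /subnK <-; elim: (j - i) => [|d IH] //=.
by rewrite addSn; apply: leq_trans IH; have := ls (size s) (d + i); rewrite take_size.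
Qed.

Lemma lis_rcons b k s : b <= k -> (forall i, k <= i -> cnt i s = 0) ->
  lis b s < lis b (rcons s (Some k)).
Proof.
elim: s b => [|[i|] s IH] b le_bk Hk /=; first by rewrite le_bk.
  have Hs j : k <= j -> cnt j s = 0 by move/Hk; rewrite cnt_cons; lia.
  have lt_ik : i < k.
    by rewrite ltnNge; apply/negP => /Hk; rewrite cnt_cons eqxx.
  by have := IH b le_bk Hs; have := IH i.+1 lt_ik Hs; case: (leqP b i); lia.
by apply: IH => // j /Hk; rewrite cnt_cons.
Qed.

Lemma lis_rcons_ge b s a : lis b s <= lis b (rcons s a).
Proof.
elim: s b => [|[i|] s IH] b //=.
by have := IH b; have := IH i.+1; case: (leqP b i); lia.
Qed.

(* The first occurrences of 0, 1, ..., k in a lattice word come in this order. *)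
Lemma lis_lattice_ge k s : lattice s -> 0 < cnt k s -> k < lis 0 s.
Proof.
elim/last_ind: s k => [|s a IH] k // /lattice_rcons [ls la] ck.
have [/eqP ck0|] := posnP (cnt k s); last by move/(IH _ ls)/leq_trans; apply; apply: lis_rcons_ge.
have Hk i : k <= i -> cnt i s = 0.
  by move/(lattice_cnt ls); rewrite (eqP ck0) leqn0 => /eqP.
move: ck la; rewrite cnt_rcons (eqP ck0) lt0b => /eqP -> la.
apply: leq_ltn_trans (lis_rcons (leq0n k) Hk).
case: k ck0 Hk la => // k ck0 Hk la; apply: IH => //.
have := la k; rewrite !cnt_rcons (eqP ck0) eqxx !eq_Some; lia.
Qed.

Lemma lis_lattice s k : lattice s ->
  (lis 0 s <= k) <-> (forall i, k <= i -> cnt i s = 0).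
Proof.
move=> ls; split=> [le_k i le_ki|Hk].
  apply/eqP; rewrite -leqn0 leqNgt; apply/negP => /(lis_lattice_ge ls).
  by rewrite ltnNge (leq_trans le_k).
by have := lis_le_bound 0 Hk; rewrite subn0.
Qed.

(** * Strips and transposition *)

Section Shapes.
Variable n : nat.
Notation box := ('I_n * 'I_n)%type.
Implicit Types (mu nu kappa : {set box}) (b : box).

Definition hadj b b' := (b'.1 == b.1) && (b'.2 == b.2.+1 :> nat).
Definition vadj b b' := (b'.2 == b.2) && (b'.1 == b.1.+1 :> nat).

Definition swap b : box := (b.2, b.1).
Definition transpose mu := [set b | swap b \in mu].

Lemma swapK : involutive swap. Proof. by case. Qed.

Lemma transposeK : involutive transpose.
Proof. by move=> mu; apply/setP=> b; rewrite !inE swapK. Qed.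

Lemma hadj_swap b b' : hadj (swap b) (swap b') = vadj b b'. Proof. by []. Qed.
Lemma vadj_swap b b' : vadj (swap b) (swap b') = hadj b b'. Proof. by []. Qed.

Definition ideal mu :=
  [forall b, forall b', (hadj b b' || vadj b b') && (b' \in mu) ==> (b \in mu)].

Lemma idealP mu :
  reflect ((forall b b', hadj b b' -> b' \in mu -> b \in mu) /\
           (forall b b', vadj b b' -> b' \in mu -> b \in mu)) (ideal mu).
Proof.
apply: (iffP forallP) => [H|[H1 H2] b].
  split=> b b' adj b'mu; have /forallP/(_ b') /implyP := H b; apply;
  by rewrite adj ?orbT.
by apply/forallP => b'; apply/implyP => /andP[/orP[] adj]; [apply: H1|apply: H2].
Qed.

Lemma ideal_transpose mu : ideal (transpose mu) = ideal mu.
Proof.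
have half la : ideal la -> ideal (transpose la).
  move/idealP => [H1 H2]; apply/idealP; split=> b b'; rewrite !inE => adj.
    by apply: H2; rewrite vadj_swap.
  by apply: H1; rewrite hadj_swap.
by apply/idP/idP => /half //; rewrite transposeK.
Qed.

(* Intermediate shapes [kappa] such that [kappa \ mu] is a vertical strip and
   [nu \ kappa] is a horizontal strip. *)
Definition strips mu nu := [set kappa : {set box} |
  [&& mu \subset kappa, kappa \subset nu,
      [forall b, forall b', hadj b b' && (b' \in kappa) ==> (b \in mu)]
    & [forall b, forall b', vadj b b' && (b' \in nu) ==> (b \in kappa)]]].

Lemma stripsP mu nu kappa :
  reflect [/\ mu \subset kappa, kappa \subset nu,
      forall b b', hadj b b' -> b' \in kappa -> b \in mu
    & forall b b', vadj b b' -> b' \in nu -> b \in kappa] (kappa \in strips mu nu).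
Proof.
rewrite inE; apply: (iffP and4P) => -[H1 H2 H3 H4]; split=> //.
- by move=> b b' adj b'k; have /forallP/(_ b)/forallP/(_ b')/implyP := H3; apply; rewrite adj.
- by move=> b b' adj b'k; have /forallP/(_ b)/forallP/(_ b')/implyP := H4; apply; rewrite adj.
- by apply/forallP => b; apply/forallP => b'; apply/implyP => /andP[]; apply: H3.
- by apply/forallP => b; apply/forallP => b'; apply/implyP => /andP[]; apply: H4.
Qed.

Definition hpairs (S : {set box}) :=
  [set p : box * box | [&& p.1 \in S, p.2 \in S & hadj p.1 p.2]].
Definition vpairs (S : {set box}) :=
  [set p : box * box | [&& p.1 \in S, p.2 \in S & vadj p.1 p.2]].

(** Three cells stand for a 2 x 2 square: in a difference of ideals the fourth one, below [b1] and
    left of [b2], is automatic. *)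
Definition no_square (S : {set box}) :=
  [forall b, forall b1, forall b2,
    ~~ [&& b1 \in S, b \in S, b2 \in S, hadj b1 b & vadj b b2]].

Lemma hadj_inj b b1 b2 : hadj b1 b -> hadj b2 b -> b1 = b2.
Proof.
case: b b1 b2 => [i j] [i1 j1] [i2 j2] /andP[/= /eqP <- /eqP E1] /andP[/= /eqP <- /eqP E2].
by congr (_, _); apply: val_inj; apply: succn_inj; rewrite -E1 -E2.
Qed.

Lemma vadj_inj b b1 b2 : vadj b b1 -> vadj b b2 -> b1 = b2.
Proof.
case: b b1 b2 => [i j] [i1 j1] [i2 j2] /andP[/= /eqP -> /eqP E1] /andP[/= /eqP -> /eqP E2].
by congr (_, _); apply: val_inj; rewrite /= E1 E2.
Qed.

(** A cell of [S] with a left neighbour in [S] cannot belong to [kappa] (the set [L]), one with a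
    lower neighbour in [S] must belong to it (the set [M]), and all others are free. The two demands
    clash exactly at a square. Neighbouring pairs are counted in place of cells because
    transposition exchanges the two kinds of pairs. *)
Lemma card_strips mu nu : mu \subset nu -> ideal mu -> ideal nu ->
  let S := nu :\: mu in
  #|strips mu nu| =
  if no_square S then 2 ^ (#|S| - (#|hpairs S| + #|vpairs S|)) else 0.
Proof.
move=> mu_nu /idealP[mu1 mu2] /idealP[nu1 nu2] S.
pose L := [set p.2 | p in hpairs S]; pose M := [set p.1 | p in vpairs S].
have cL : #|L| = #|hpairs S|.
  apply: card_in_imset => -[a b] [c d]; rewrite !inE /= => /and3P[_ _ h1] /and3P[_ _ h2] E.
  by subst d; rewrite (hadj_inj h1 h2).
have cM : #|M| = #|vpairs S|.
  apply: card_in_imset => -[a b] [c d]; rewrite !inE /= => /and3P[_ _ h1] /and3P[_ _ h2] E.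
  by subst c; rewrite (vadj_inj h1 h2).
have LS : L \subset S by apply/subsetP => b /imsetP[p]; rewrite inE => /and3P[_ pS _] ->.
have MS : M \subset S by apply/subsetP => b /imsetP[p]; rewrite inE => /and3P[pS _ _] ->.
have MV b b' : vadj b b' -> b \in S -> b' \in nu -> b \in M.
  move=> adj bS b'nu; apply/imsetP; exists (b, b') => //=.
  rewrite inE /= bS adj andbT /= !inE b'nu andbT.
  by apply: contraL bS => /(mu2 _ _ adj) bmu; rewrite !inE bmu.
have LH b b' : hadj b b' -> b' \in S -> b \notin mu -> b' \in L.
  move=> adj b'S bmu; apply/imsetP; exists (b, b') => //=.
  rewrite inE /= b'S adj andbT /= !inE bmu /= (nu1 _ _ adj) //.
  by move: b'S; rewrite inE => /andP[].
case: ifPn => [sq|]; last first.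
  rewrite negb_forall => /existsP[b]; rewrite negb_forall => /existsP[b1].
  rewrite negb_forall => /existsP[b2]; rewrite negbK => /and5P[b1S bS b2S h v].
  apply: eq_card0 => kappa; apply/negbTE/stripsP => -[_ _ H1 H2].
  move: b1S b2S; rewrite !in_setD => /andP[b1mu _] /andP[_ b2nu].
  by rewrite (H1 _ _ h (H2 _ _ v b2nu)) in b1mu.
have LM b : b \in L -> b \in M -> False.
  case/imsetP=> -[b1 b'] /= + ?; subst b'; rewrite inE /= => /and3P[b1S bS h].
  case/imsetP=> -[b' b2] /= + ?; subst b'; rewrite inE /= => /and3P[_ b2S v].
  by move/forallP/(_ b)/forallP/(_ b1)/forallP/(_ b2): sq; rewrite b1S bS b2S h v.
pose F := S :\: (L :|: M).
have cF : #|F| = #|S| - (#|hpairs S| + #|vpairs S|).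
  rewrite cardsD (setIidPr _) ?subUset ?LS //.
  rewrite -cL -cM cardsU (_ : L :&: M = set0) ?cards0 ?subn0 //.
  by apply/setP=> b; rewrite in_setI in_set0; apply/negP => /andP[]; apply: LM.
rewrite -cF -card_powerset.
have -> : strips mu nu = [set (mu :|: M) :|: X | X in powerset F].
  apply/setP=> kappa; apply/stripsP/imsetP => [[H1 H2 H3 H4]|].
    exists (kappa :&: F).
      by rewrite powersetE subsetIr.
    apply/setP=> b; rewrite !in_setU in_setI.
    have [bmu|bmu] := boolP (b \in mu); first by rewrite (subsetP H1).
    have [bM|bM] := boolP (b \in M).
      case/imsetP: bM => -[b0 b'] /= + ->; rewrite !inE /= => /and3P[_ /andP[_ ?] v].
      by rewrite (H4 _ _ v).
    have [bk|//] := boolP (b \in kappa).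
    rewrite /= in_setD in_setU (negPf bM) orbF in_setD bmu (subsetP H2) // !andbT.
    apply/esym/negP => /imsetP[[b1 b0]] /= + E; subst b0; rewrite inE /= => /and3P[].
    by rewrite in_setD => /andP[b1mu _] _ h; rewrite (H3 _ _ h bk) in b1mu.
  case=> X; rewrite powersetE => XF ->; have XS b : b \in X -> b \in S /\ b \notin L.
    by move/(subsetP XF); rewrite in_setD in_setU negb_or => /andP[/andP[]].
  have XMS b : b \in mu :|: M :|: X -> b \notin mu -> b \in S /\ b \notin L.
    rewrite !in_setU => /orP[/orP[->//|bM] _|/XS//].
    by rewrite (subsetP MS) //; split=> //; apply/negP => /LM; apply.
  split.
  - by rewrite -setUA subsetUl.
  - apply/subsetP => b bk; have [/(subsetP mu_nu) //|/(XMS _ bk)[]] := boolP (b \in mu).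
    by rewrite inE => /andP[].
  - move=> b b' h b'k; apply: contraT => bmu.
    have b'mu : b' \notin mu by apply: contra bmu; apply: mu1.
    by case: (XMS _ b'k b'mu) => b'S; rewrite (LH _ _ h).
  - move=> b b' v b'nu; rewrite !in_setU; have [//|bmu] := boolP (b \in mu).
    by rewrite (MV _ _ v) // in_setD bmu (nu2 _ _ v).
apply: card_in_imset => X Y; rewrite !powersetE => XF YF E.
have aux (Z : {set box}) : Z \subset F -> Z = (mu :|: M :|: Z) :&: F.
  move=> ZF; rewrite setIUl (setIidPl ZF) (_ : _ :&: F = set0) ?set0U //.
  apply/setP=> b; rewrite in_set0 in_setI in_setU in_setD in_setU negb_or in_setD.
  by case: (b \in mu); case: (b \in M) => //=; rewrite ?andbF.
by rewrite (aux X) // E -aux.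
Qed.

Lemma card_transpose mu : #|transpose mu| = #|mu|.
Proof.
rewrite -(card_imset (mem mu) (can_inj swapK)); apply: eq_card => b.
rewrite inE; apply/idP/imsetP => [bm|[c cm ->]]; last by rewrite swapK.
by exists (swap b); rewrite ?swapK.
Qed.

Lemma subset_transpose mu nu : (transpose mu \subset transpose nu) = (mu \subset nu).
Proof.
apply/subsetP/subsetP => H b; last by rewrite !inE; apply: H.
by have := H (swap b); rewrite !inE swapK.
Qed.

(** The exponent is symmetric in the two kinds of pairs. For squares, [key] and [key'] pass between
    the upper right and the lower left cell. *)
Lemma card_strips_transpose mu nu : mu \subset nu -> ideal mu -> ideal nu ->
  #|strips (transpose mu) (transpose nu)| = #|strips mu nu|.
Proof.
move=> mu_nu imu inu.
rewrite !card_strips ?subset_transpose ?ideal_transpose //.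
set S := nu :\: mu; have -> : transpose nu :\: transpose mu = transpose S.
  by apply/setP=> b; rewrite !inE.
pose sw2 (p : box * box) := (swap p.1, swap p.2).
have sw2K : involutive sw2 by case=> -[a b] [c d].
have Eh : #|hpairs (transpose S)| = #|vpairs S|.
  rewrite -(card_imset (mem (vpairs S)) (can_inj sw2K)); apply: eq_card => p.
  rewrite !inE; apply/idP/imsetP => [bm|[c cm ->]]; last first.
    by move: cm; rewrite !inE /= !swapK hadj_swap.
  by exists (sw2 p); rewrite ?sw2K // !inE /= vadj_swap.
have Ev : #|vpairs (transpose S)| = #|hpairs S|.
  rewrite -(card_imset (mem (hpairs S)) (can_inj sw2K)); apply: eq_card => p.
  rewrite !inE; apply/idP/imsetP => [bm|[c cm ->]]; last first.
    by move: cm; rewrite !inE /= !swapK vadj_swap.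
  by exists (sw2 p); rewrite ?sw2K // !inE /= hadj_swap.
rewrite card_transpose Eh Ev addnC.
suff -> : no_square (transpose S) = no_square S by [].
move: imu inu => /idealP[mu1 mu2] /idealP[nu1 nu2].
have key b b1 b2 : b1 \in S -> b \in S -> b2 \in S -> vadj b1 b -> hadj b b2 ->
    exists b', [&& b1 \in S, b' \in S, b2 \in S, hadj b1 b' & vadj b' b2].
  move=> b1S bS b2S v h; exists (b1.1, b2.2); rewrite b1S b2S /=.
  move: (v) (h) => /andP[/eqP e1 /eqP e2] /andP[/eqP e3 /eqP e4].
  have hb : hadj b1 (b1.1, b2.2) by rewrite /hadj /= eqxx e4 e1 eqxx.
  have vb : vadj (b1.1, b2.2) b2 by rewrite /vadj /= eqxx e3 e2 eqxx.
  rewrite hb vb andbT in_setD; move: b1S b2S; rewrite !in_setD.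
  move=> /andP[b1mu _] /andP[_ b2nu]; rewrite (nu2 _ _ vb) // !andbT.
  by apply: contra b1mu; apply: mu1.
have key' b b1 b2 : b1 \in S -> b \in S -> b2 \in S -> hadj b1 b -> vadj b b2 ->
    exists b', [&& b1 \in S, b' \in S, b2 \in S, vadj b1 b' & hadj b' b2].
  move=> b1S bS b2S h v; exists (b2.1, b1.2); rewrite b1S b2S /=.
  move: (h) (v) => /andP[/eqP e1 /eqP e2] /andP[/eqP e3 /eqP e4].
  have vb : vadj b1 (b2.1, b1.2) by rewrite /vadj /= eqxx e4 e1 eqxx.
  have hb : hadj (b2.1, b1.2) b2 by rewrite /hadj /= eqxx e3 e2 eqxx.
  rewrite hb vb andbT in_setD; move: b1S b2S; rewrite !in_setD.
  move=> /andP[b1mu _] /andP[_ b2nu]; rewrite (nu1 _ _ hb) // !andbT.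
  by apply: contra b1mu; apply: mu2.
apply/idP/idP => sq; apply/forallP => b; apply/forallP => b1; apply/forallP => b2;
  apply/negP => /and5P[].
  move=> b1S bS b2S h v; have [b'] := key' _ _ _ b1S bS b2S h v.
  move=> /and5P[_ b'S _ v' h']; move/forallP/(_ (swap b'))/forallP/(_ (swap b1)): sq.
  by move/forallP/(_ (swap b2)); rewrite !inE !swapK -!in_setD b1S b'S b2S hadj_swap vadj_swap v' h'.
rewrite !(in_set (fun b => swap b \in S)) => b1S bS b2S h v.
rewrite -vadj_swap in h; rewrite -hadj_swap in v.
have [b'] := key _ _ _ b1S bS b2S h v => /and5P[_ b'S _ h' v'].
move/forallP/(_ b')/forallP/(_ (swap b1))/forallP/(_ (swap b2)): sq.
by rewrite b1S b'S b2S h' v'.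
Qed.

End Shapes.

(** * V-shaped blocks of columns *)

(** The row indices rise strictly and then fall weakly; the V is that of the permutation, which
    descends where the row index rises. *)
Fixpoint vshape (l : seq nat) :=
  if l is x :: l' then
    if l' is y :: _ then (if x < y then vshape l' else sorted geq l') else true
  else true.

Definition split_at (l : seq nat) j := sorted ltn (take j l) && sorted geq (drop j l).

Lemma count_iotaS (f : pred nat) m :
  count f (iota 0 m.+1) = f 0 + count (fun j => f j.+1) (iota 0 m).
Proof. by rewrite /= (iotaDl 1 0) count_map. Qed.

(* The minimum of a V-shaped word can be attached to either side. *)
Lemma card_split_at l : 0 < size l ->
  count (split_at l) (iota 0 (size l).+1) = vshape l * 2.
Proof.
elim: l => [|x [|y l] IH] // _.
set l' := y :: l in IH *; have {}IH := IH isT.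
have -> : vshape (x :: l') = if x < y then vshape l' else sorted geq l' by [].
rewrite -[size (x :: l')]/(size l').+1 count_iotaS count_iotaS.
rewrite count_iotaS in IH.
have E0 : split_at (x :: l') 0 = (y <= x) && sorted geq l' by [].
have E1 : split_at (x :: l') 1 = sorted geq l' by [].
have ES j : split_at (x :: l') j.+2 = (x < y) && split_at l' j.+1.
  by rewrite /split_at /= andbA.
have EC : count (fun j => split_at (x :: l') j.+2) (iota 0 (size l')) =
   (x < y) * count (fun j => split_at l' j.+1) (iota 0 (size l')).
  by elim: (iota 0 _) => [|j t IHt]; rewrite ?muln0 // [LHS]/= IHt ES mulnDr mulnb.
rewrite E0 E1 EC; move: IH.
rewrite {1}/split_at take0 drop0 -[sorted ltn [::]]/true andTb.
by case: ltnP; case: (sorted geq l'); case: (vshape l'); lia.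
Qed.

Lemma vshapeP l : reflect
  (forall j, j.+2 < size l -> nth 0 l j.+1 <= nth 0 l j -> nth 0 l j.+2 <= nth 0 l j.+1)
  (vshape l).
Proof.
elim: l => [|x [|y l] IH]; [by left | by left | ].
have -> : vshape (x :: y :: l) = if x < y then vshape (y :: l) else sorted geq (y :: l) by [].
case: ltnP => [lt_xy|le_yx].
  apply: (iffP IH) => H; last by move=> j lt_j; apply: (H j.+1).
  by case=> [|j] lt_j /=; [rewrite leqNgt lt_xy | apply: H].
apply: (iffP idP) => [so [|j]|H].
- by move=> lt_l _; move/(sortedP 0)/(_ 0 lt_l): so.
- by move=> lt_l _; move/(sortedP 0)/(_ j.+1 lt_l): so.
apply/(sortedP 0) => j; elim: j => [|j IHj] lt_j; first exact: (H 0).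
by apply: (H j.+1) => //; apply: IHj; apply: ltnW.
Qed.

Lemma cnt_map i (t : seq nat) : cnt i (map Some t) = count_mem i t.
Proof. by rewrite /cnt count_map. Qed.

Lemma take_cat_leq (T : Type) q (s t : seq T) :
  (q <= size s /\ take q (s ++ t) = take q s) \/
  (exists q', take q (s ++ t) = s ++ take q' t).
Proof.
have [le_q|lt_q] := leqP q (size s); first by left; rewrite takel_cat.
by right; exists (q - size s); rewrite take_cat ltnNge (ltnW lt_q).
Qed.

Lemma lattice_cat_geq s t : lattice s ->
  (forall i, cnt i.+1 (s ++ map Some t) <= cnt i s) -> lattice (s ++ map Some t).
Proof.
move=> ls H q i; case: (take_cat_leq q s (map Some t)) => [[_ ->]|[q' ->]]; first exact: ls.
have : cnt i.+1 (take q' (map Some t)) <= cnt i.+1 (map Some t).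
  by rewrite -{2}(cat_take_drop q' (map Some t)) cnt_cat leq_addr.
by rewrite !cnt_cat; have := H i; rewrite cnt_cat; lia.
Qed.

(** In a weakly decreasing block every [i.+1] precedes every [i]. The lattice condition at the point
    between them says that the block adds a horizontal strip. *)
Lemma cat_geq_lattice s t : lattice (s ++ map Some t) -> sorted geq t ->
  forall i, cnt i.+1 (s ++ map Some t) <= cnt i s.
Proof.
move=> lst so i.
have Et : t = [seq j <- t | i < j] ++ [seq j <- t | j <= i].
  elim: t so {lst} => //= j t IH so; have {}IH := IH (path_sorted so).
  case: (ltnP i j) => [lt_ij|le_ji] /=; first by rewrite {1}IH.
  have [-> ->] // : [seq j <- t | i < j] = [::] /\ [seq j <- t | j <= i] = t.
  have all_t : all (fun j => j <= i) t.
    have gt : transitive geq by move=> ? ? ?; move=> /= H1 H2; apply: leq_trans H2 H1.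
    move: so; rewrite (path_sortedE gt) => /andP[/allP H _].
    by apply/allP => x /H /= /leq_trans; apply.
  split; last by apply/all_filterP.
  apply/eqP; rewrite -(negbK (_ == _)) -has_filter -all_predC.
  by apply: sub_all all_t => x /=; rewrite -leqNgt.
have [A [B [E HA HB]]] : exists A B, [/\ t = A ++ B, i \notin A & i.+1 \notin B].
  by exists [seq j <- t | i < j], [seq j <- t | j <= i]; rewrite !mem_filter !ltnn.
have := lst (size s + size A) i; subst t.
rewrite map_cat !catA take_size_cat ?size_cat ?size_map //.
by rewrite !cnt_cat !cnt_map (count_memPn HA) (count_memPn HB) !addn0.
Qed.

(** A strictly increasing block has each letter at most once, and [i] before [i.+1]. A prefix with
    [i.+1] thus already has every [i] of the block, and the full counts suffice. *)
Lemma lattice_cat_ltn s t : lattice s -> sorted ltn t ->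
  (forall i, cnt i.+1 (s ++ map Some t) <= cnt i (s ++ map Some t)) ->
  lattice (s ++ map Some t).
Proof.
move=> ls so H q i; case: (take_cat_leq q s (map Some t)) => [[_ ->]|[q' ->]]; first exact: ls.
rewrite -map_take !cnt_cat !cnt_map; have := ls (size s) i; rewrite take_size.
have ut : uniq t by apply: sorted_uniq so; [exact: ltn_trans | exact: ltnn].
have [mt|/count_memPn ->] := boolP (i.+1 \in take q' t); last by rewrite addn0; lia.
rewrite !count_uniq_mem ?take_uniq // mt.
have := H i; rewrite !cnt_cat !cnt_map !count_uniq_mem // (mem_take mt).
have [mi|_] := boolP (i \in t); last by lia.
suff -> : i \in take q' t by lia.
rewrite -{1}(cat_take_drop q' t) mem_cat in mi; case/orP: mi => // mi.
have st : sorted ltn (take q' t ++ drop q' t) by rewrite cat_take_drop.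
move: st; rewrite (sorted_pairwise ltn_trans) pairwise_cat => /and3P[/allrelP al _ _].
by have := al _ _ mt mi; rewrite /= ltnNge leqnSn.
Qed.

(** * Shapes of lattice words and the blocks between two shapes *)

Section Shape.
Variable n : nat.
Notation box := ('I_n * 'I_n)%type.
Implicit Types (mu nu kappa : {set box}).

Definition shape s : {set box} := [set b : box | b.2 < cnt b.1 s].

Lemma mem_shape s (i j : 'I_n) : ((i, j) \in shape s) = (j < cnt i s).
Proof. by rewrite inE. Qed.

Lemma ideal_shape s : lattice s -> ideal (shape s).
Proof.
move=> ls; apply/idealP; split=> -[i j] [i' j'] /andP[/= /eqP e1 /eqP e2]; rewrite !mem_shape.
  by rewrite e1 e2; apply: leq_trans.
by rewrite e1 e2 => /leq_trans; apply; apply: lattice_cnt.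
Qed.

Lemma cnt_size i s : cnt i s <= size s. Proof. exact: count_size. Qed.

Lemma lattice_cnt_size k s : lattice s -> 0 < cnt k s -> k < size s.
Proof.
move=> ls /(lis_lattice_ge ls) lt_k; apply: leq_trans lt_k _.
have lis_size b t : lis b t <= size t.
  elim: t b => [|[i|] t IH] b //=; last exact: leqW.
  by have := IH b; have := IH i.+1; case: (leqP b i); lia.
exact: lis_size.
Qed.

(** Row indices in use and row lengths are bounded by the size of a lattice word, so the [n] by [n]
    grid cuts nothing off. *)
Lemma shape_inj s t : lattice s -> lattice t -> size s <= n -> size t <= n ->
  shape s = shape t -> forall i, cnt i s = cnt i t.
Proof.
have aux s1 t1 i : lattice s1 -> size s1 <= n -> shape s1 = shape t1 -> cnt i s1 <= cnt i t1.
  move=> ls szs E; case: (posnP (cnt i s1)) => [->//|ci0].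
  have lt_i : i < n := leq_trans (lattice_cnt_size ls ci0) szs.
  have lt_c : (cnt i s1).-1 < n.
    by rewrite prednK //; apply: leq_trans (cnt_size i s1) szs.
  have : (Ordinal lt_i, Ordinal lt_c) \in shape t1 by rewrite -E mem_shape /= prednK.
  by rewrite mem_shape /= prednK.
by move=> ls lt szs szt E i; apply/eqP; rewrite eqn_leq !aux.
Qed.

Lemma card_lt_ord m : #|[set k : 'I_n | k < m]| = minn m n.
Proof.
rewrite cardsE cardE size_filter -(count_map val (fun k => k < m)) -enumT val_enum_ord.
elim: n m => [|p IH] m; first by rewrite minn0.
rewrite -addn1 iotaD count_cat IH /= add0n addn0.
by case: (ltnP p m); lia.
Qed.

Definition rowlen mu (i : 'I_n) := #|[set j | (i, j) \in mu]|.

Lemma down_closed_card (A : {set 'I_n}) :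
  (forall i j : 'I_n, j = i.+1 :> nat -> j \in A -> i \in A) ->
  forall j : 'I_n, (j \in A) = (j < #|A|).
Proof.
move=> dc j.
have dc' (i k : 'I_n) : i <= k -> k \in A -> i \in A.
  move=> le_ik; have [d Ed] : exists d, i + d = k by exists (k - i); rewrite subnKC.
  elim: d k Ed {le_ik} => [|d IH] k Ed kA.
    by rewrite (_ : i = k) //; apply: val_inj; rewrite /= -Ed addn0.
  have lt_n : i + d < n by apply: leq_trans (ltn_ord k); rewrite -Ed addnS.
  by apply: (IH (Ordinal lt_n)) => //; apply: dc kA; rewrite /= -Ed addnS.
have card_lt m : m <= n -> #|[set k : 'I_n | k < m]| = m.
  by move=> le_m; rewrite card_lt_ord (minn_idPl le_m).
apply/idP/idP => [jA|].
  rewrite -(card_lt j.+1 (ltn_ord j)); apply: subset_leq_card.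
  by apply/subsetP => k; rewrite inE ltnS => /dc'; apply.
apply: contraTT => jA; rewrite -leqNgt -(card_lt j (ltnW (ltn_ord j))).
apply: subset_leq_card; apply/subsetP => k kA; rewrite inE ltnNge.
by apply: contra jA => /dc'; apply.
Qed.

Lemma mem_rowlen mu i j : ideal mu -> ((i, j) \in mu) = (j < rowlen mu i).
Proof.
move=> /idealP[H _]; rewrite -down_closed_card ?inE // => j1 j2 E.
by rewrite !inE; apply: H; rewrite /hadj /= eqxx E eqxx.
Qed.

Lemma rowlen_shape s i : size s <= n -> rowlen (shape s) i = cnt i s.
Proof.
move=> szs; have le_n : cnt i s <= n by apply: leq_trans (cnt_size _ _) szs.
rewrite -[RHS](minn_idPl le_n) -card_lt_ord.
by apply: eq_card => k; rewrite !inE.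
Qed.

Lemma shape_rowlen s kappa : ideal kappa -> (forall i : 'I_n, cnt i s = rowlen kappa i) ->
  shape s = kappa.
Proof.
by move=> ik E; apply/setP => -[i j]; rewrite mem_shape E mem_rowlen.
Qed.

Lemma count_rows (A : {set box}) (i : 'I_n) :
  count_mem (i : nat) [seq val b.1 | b <- enum A] = rowlen A i.
Proof.
rewrite count_map -size_filter /rowlen.
rewrite -(size_map snd) -(card_uniqP _); last first.
  rewrite map_inj_in_uniq; first exact/filter_uniq/enum_uniq.
  move=> -[a b] [c d].
  rewrite !mem_filter /= => /andP[/eqP/val_inj -> _] /andP[/eqP/val_inj -> _] ->.
  by [].
apply: eq_card => j; rewrite inE; apply/mapP/idP => [[[a b]]|ijA].
  by rewrite mem_filter mem_enum => /andP[/eqP/val_inj/= -> abA] ->.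
by exists (i, j); rewrite // mem_filter mem_enum ijA /= eqxx.
Qed.

Lemma rowlenD kappa mu i : mu \subset kappa ->
  rowlen mu i + rowlen (kappa :\: mu) i = rowlen kappa i.
Proof.
move=> sub; rewrite /rowlen -[RHS](cardsID [set j | (i, j) \in mu]); congr (_ + _); last first.
  by apply: eq_card => j; rewrite !inE.
apply: eq_card => j; rewrite !inE; apply/idP/andP => [ijm|[]//].
by rewrite (subsetP sub).
Qed.

Definition vblocks s a nu := [set z : a.-tuple 'I_n |
  [&& vshape (map val z), `[< lattice (s ++ map (fun i : 'I_n => Some (val i)) z) >]
    & shape (s ++ map (fun i : 'I_n => Some (val i)) z) == nu]].

Let some (z : seq 'I_n) := map (fun i : 'I_n => Some (val i)) z.

Lemma seq_ord (l : seq nat) : all (fun i => i < n) l ->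
  exists z : seq 'I_n, map val z = l.
Proof.
elim: l => [_|i l IH /= /andP[lt_i /IH[z <-]]]; first by exists [::].
by exists (Ordinal lt_i :: z).
Qed.

(** A strictly increasing word, and likewise a weakly decreasing one, is determined by its letter
    counts. The intermediate shape and [nu] give these counts for both parts. *)
Lemma vblocks_inj s a nu (z z' : a.-tuple 'I_n) j j' :
  lattice s -> size s + a <= n -> j <= a -> j' <= a ->
  z \in vblocks s a nu -> z' \in vblocks s a nu ->
  split_at (map val z) j -> split_at (map val z') j' ->
  shape (s ++ some (take j z)) = shape (s ++ some (take j' z')) ->
  z = z' /\ j = j'.
Proof.
move=> ls sz lj lj'; rewrite !inE => /and3P[_ /asboolP lz /eqP Ez] /and3P[_ /asboolP lz' /eqP Ez'].
move=> /andP[s1 s2] /andP[s1' s2'] E.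
rewrite -/(some z) in lz Ez; rewrite -/(some z') in lz' Ez'.
have lt k (y : a.-tuple 'I_n) : lattice (s ++ some y) -> lattice (s ++ some (take k y)).
  by move/(@lattice_take (size s + k)); rewrite take_cat ltnNge leq_addr /= addKn /some map_take.
have st k (y : a.-tuple 'I_n) : size (s ++ some (take k y)) <= n.
  by rewrite size_cat size_map size_take_min size_tuple (leq_trans _ sz) // leq_add2l geq_minr.
have someE (y : seq 'I_n) : some y = map Some (map val y) by rewrite -map_comp.
have E1 i : count_mem i (map val (take j z)) = count_mem i (map val (take j' z')).
  have := shape_inj (lt _ _ lz) (lt _ _ lz') (st _ _) (st _ _) E i.
  by rewrite !cnt_cat !someE !cnt_map => /addnI.
have Ea i : count_mem i (map val z) = count_mem i (map val z').
  have stt (y : a.-tuple 'I_n) : size (s ++ some y) <= n.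
    by rewrite size_cat size_map size_tuple.
  have := shape_inj lz lz' (stt _) (stt _) (etrans Ez (esym Ez')) i.
  by rewrite !cnt_cat !someE !cnt_map => /addnI.
have E2 i : count_mem i (map val (drop j z)) = count_mem i (map val (drop j' z')).
  have := Ea i; rewrite -{1}(cat_take_drop j z) -{1}(cat_take_drop j' z') !map_cat !count_cat.
  by rewrite E1 => /addnI.
have {}E1 : map val (take j z) = map val (take j' z').
  apply: (sorted_eq leq_trans anti_leq).
  - by move: s1; rewrite map_take; apply: sub_sorted => x y /ltnW.
  - by move: s1'; rewrite map_take; apply: sub_sorted => x y /ltnW.
  - by apply/allP => x _; apply/eqP.
have {}E2 : map val (drop j z) = map val (drop j' z').
  apply: (@sorted_eq _ geq).
  - by move=> x y t /= H1 H2; apply: leq_trans H2 H1.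
  - by move=> x y /=; rewrite andbC => /anti_leq.
  - by move: s2; rewrite map_drop.
  - by move: s2'; rewrite map_drop.
  - by apply/allP => x _; apply/eqP.
split; last first.
  have := congr1 size E1; rewrite !size_map !size_take_min !size_tuple.
  by rewrite (minn_idPl lj) (minn_idPl lj').
apply: val_inj; apply: (inj_map val_inj).
by rewrite /= -(cat_take_drop j z) -(cat_take_drop j' z') !map_cat E1 E2.
Qed.

(** List the rows of the cells of [kappa :\: shape s] upwards, then those of [nu :\: kappa]
    downwards. The vertical strip makes the first list strict, and the horizontal strip makes the
    second extension a lattice word. *)
Lemma strips_surj s a nu kappa : lattice s -> size s + a <= n -> 0 < a ->
  ideal nu -> #|nu :\: shape s| = a -> kappa \in strips (shape s) nu ->
  exists z : a.-tuple 'I_n, exists j : 'I_a.+1,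
    [/\ z \in vblocks s a nu, split_at (map val z) j & shape (s ++ some (take j z)) = kappa].
Proof.
move=> ls sz a0 inu card_nu /stripsP[mk kn H V].
set mu := shape s in card_nu mk H *.
have imu : ideal mu by apply: ideal_shape.
have ik : ideal kappa.
  apply/idealP; split=> b b' adj bk; first by apply: (subsetP mk); apply: H adj bk.
  by apply: V adj _; apply: (subsetP kn).
pose rows (A : {set box}) := [seq val b.1 | b <- enum A].
have rows_lt A : all (fun i => i < n) (rows A) by apply/allP => _ /mapP[b _ ->]; apply: ltn_ord.
pose t1 := sort leq (rows (kappa :\: mu)); pose t2 := sort geq (rows (nu :\: kappa)).
have ct1 i : count_mem i t1 = count_mem i (rows (kappa :\: mu)).
  by apply/seq.permP; rewrite perm_sort.
have ct2 i : count_mem i t2 = count_mem i (rows (nu :\: kappa)).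
  by apply/seq.permP; rewrite perm_sort.
have size12 : size (t1 ++ t2) = a.
  rewrite size_cat !size_sort !size_map -!cardE -card_nu.
  rewrite -[RHS](cardsID kappa); congr (_ + _); apply: eq_card => b; rewrite !inE.
    by case: (boolP (b \in kappa)) => [/(subsetP kn)->|]; rewrite ?andbF ?andbT.
  case: (boolP (b \in kappa)) => //= bk.
  by have := contra (subsetP mk b) bk; rewrite inE => ->.
have [z Ez] : exists z : seq 'I_n, map val z = t1 ++ t2.
  by apply: seq_ord; rewrite all_cat !all_sort !rows_lt.
have sizez : size z == a by rewrite -(size_map val) Ez size12.
have cnt_big l i : n <= i -> all (fun i => i < n) l -> count_mem i l = 0.
  by move=> le_n /allP al; apply/count_memPn/negP => /al; rewrite ltnNge le_n.
have szs : size s <= n by apply: leq_trans sz; apply: leq_addr.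
have cnt_s_big i : n <= i -> cnt i s = 0.
  move=> le_n; apply/eqP; rewrite -leqn0 leqNgt; apply/negP => /(lattice_cnt_size ls).
  by rewrite ltnNge (leq_trans szs).
have c1 (i : 'I_n) : cnt i (s ++ map Some t1) = rowlen kappa i.
  by rewrite cnt_cat cnt_map ct1 count_rows -(rowlen_shape i szs) rowlenD.
have c2 (i : 'I_n) : cnt i ((s ++ map Some t1) ++ map Some t2) = rowlen nu i.
  by rewrite cnt_cat c1 cnt_map ct2 count_rows rowlenD.
have c1big i : n <= i -> cnt i (s ++ map Some t1) = 0.
  by move=> le_n; rewrite cnt_cat cnt_s_big // cnt_map cnt_big // all_sort rows_lt.
have c2big i : n <= i -> cnt i ((s ++ map Some t1) ++ map Some t2) = 0.
  by move=> le_n; rewrite cnt_cat c1big // cnt_map cnt_big // all_sort rows_lt.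
have so1 : sorted ltn t1.
  rewrite ltn_sorted_uniq_leq sort_uniq sort_sorted ?andbT; last exact: leq_total.
  rewrite map_inj_in_uniq ?enum_uniq // => -[i j] [i' j'].
  have aux (j1 j2 : 'I_n) : (i, j1) \in kappa :\: mu -> (i, j2) \in kappa :\: mu -> ~~ (j1 < j2).
    rewrite !in_setD => /andP[m1 _] /andP[_ k2]; apply: contra m1 => lt_j.
    have lt_j' : j2.-1 < n by apply: leq_ltn_trans (leq_pred _) (ltn_ord j2).
    have j2K : j2.-1.+1 = j2 by rewrite prednK // (leq_ltn_trans _ lt_j).
    have : (i, Ordinal lt_j') \in mu.
      by apply: H k2; rewrite /hadj /= eqxx j2K eqxx.
    by rewrite !mem_rowlen //=; apply: leq_ltn_trans; rewrite -ltnS j2K.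
  rewrite !mem_enum => b1 b2 /= /val_inj E; subst i'.
  have le1 : j' <= j by rewrite leqNgt; exact: aux b1 b2.
  have le2 : j <= j' by rewrite leqNgt; exact: aux b2 b1.
  by congr (_, _); apply/ord_inj/anti_leq; rewrite le1 le2.
have so2 : sorted geq t2 by apply: sort_sorted => x y; apply: leq_total.
have l1 : lattice (s ++ map Some t1).
  apply: lattice_cat_ltn => // i; have [le_n|lt_n] := leqP n i.+1; first by rewrite c1big.
  rewrite (c1 (Ordinal lt_n)) (c1 (Ordinal (ltnW lt_n))).
  apply: subset_leq_card; apply/subsetP => j; rewrite !inE.
  by have /idealP[_] := ik; apply; rewrite /vadj /= !eqxx.
have l2 : lattice ((s ++ map Some t1) ++ map Some t2).
  apply: lattice_cat_geq => // i; have [le_n|lt_n] := leqP n i.+1; first by rewrite c2big.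
  rewrite (c2 (Ordinal lt_n)) (c1 (Ordinal (ltnW lt_n))).
  apply: subset_leq_card; apply/subsetP => j; rewrite !inE.
  by apply: V; rewrite /vadj /= !eqxx.
have split12 : split_at (t1 ++ t2) (size t1).
  by rewrite /split_at take_size_cat // drop_size_cat // so1 so2.
have lt1 : size t1 < a.+1 by rewrite ltnS -size12 size_cat leq_addr.
have someE (y : seq 'I_n) : some y = map Some (map val y) by rewrite -map_comp.
exists (Tuple sizez), (Ordinal lt1); split.
- rewrite inE /= -/(some z) someE Ez map_cat catA; apply/and3P; split.
  + suff : 0 < vshape (t1 ++ t2) * 2 by case: (vshape _).
    rewrite -card_split_at ?size12 // -has_count; apply/hasP.
    by exists (size t1); rewrite // mem_iota.
  + exact/asboolP.
  + by apply/eqP; apply: shape_rowlen.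
- by rewrite /= Ez.
rewrite /= someE map_take Ez take_size_cat //.
by apply: shape_rowlen.
Qed.

(** Count pairs of a block and a split point: a nonempty V-shaped block has two split points, and
    the pairs correspond to the intermediate shapes. *)
Lemma card_vblocks s a nu : lattice s -> size s + a <= n -> 0 < a ->
  ideal nu -> #|nu :\: shape s| = a ->
  #|vblocks s a nu| * 2 = #|strips (shape s) nu|.
Proof.
move=> ls sz a0 inu card_nu.
pose P := [set p : a.-tuple 'I_n * 'I_a.+1 |
  (p.1 \in vblocks s a nu) && split_at (map val p.1) p.2].
have -> : #|vblocks s a nu| * 2 = #|P|.
  rewrite -sum1_card big_distrl /= -sum1_card (eq_bigl (fun p : a.-tuple 'I_n * 'I_a.+1 =>
    (p.1 \in vblocks s a nu) && split_at (map val p.1) p.2)); last by move=> p; rewrite inE.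
  rewrite -(pair_big_dep (mem (vblocks s a nu)) (fun z (j : 'I_a.+1) => split_at (map val (tval z)) j)
    (fun _ _ => 1)) /=.
  apply: eq_bigr => z zv; rewrite -(big_mkord (split_at _) (fun=> 1)) sum1_count /index_iota subn0.
  have szz : size (map val z) = a by rewrite size_map size_tuple.
  have := @card_split_at (map val z); rewrite szz => -> //.
  by move: zv; rewrite inE => /and3P[-> _ _].
pose phi (p : a.-tuple 'I_n * 'I_a.+1) := shape (s ++ some (take p.2 p.1)).
rewrite -(@card_in_imset _ _ phi); last first.
  move=> [z j] [z' j']; rewrite !inE /= => /andP[zv zs] /andP[zv' zs'] E.
  have [-> Ej] : z = z' /\ j = j' :> nat.
    by apply: (@vblocks_inj s a nu) => //; rewrite ?inE // -ltnS.
  by congr (_, _); apply: val_inj.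
apply: eq_card => kappa; apply/imsetP/idP => [[[z j]]|kst]; last first.
  have [z [j [zv zs <-]]] := strips_surj ls sz a0 inu card_nu kst.
  by exists (z, j); rewrite // inE zv zs.
rewrite in_set => /andP[/=]; rewrite in_set => /and3P[_ /asboolP lz /eqP Ez] /andP[s1 s2] ->.
have someE (y : seq 'I_n) : some y = map Some (map val y) by rewrite -map_comp.
have Es : s ++ some z = (s ++ some (take j z)) ++ map Some (drop j (map val z)).
  by rewrite -map_drop -someE -catA -map_cat cat_take_drop.
have cnt_take i : cnt i (some (take j z)) = count_mem i (take j (map val z)).
  by rewrite someE cnt_map map_take.
rewrite -/(some z) in lz Ez.
apply/stripsP; split.
- by apply/subsetP => -[i k]; rewrite !mem_shape cnt_cat => /leq_trans; apply; apply: leq_addr.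
- rewrite -Ez Es; apply/subsetP => -[i k]; rewrite !mem_shape => /leq_trans; apply.
  by rewrite [X in _ <= X]cnt_cat leq_addr.
- move=> [i k] [i' k'] /andP[/= /eqP -> /eqP e]; rewrite !mem_shape cnt_cat e cnt_take.
  have ut : uniq (take j (map val z)) by apply: sorted_uniq s1; [exact: ltn_trans | exact: ltnn].
  by rewrite count_uniq_mem //; case: (_ \in _) => /=; lia.
- move=> [i k] [i' k'] /andP[/= /eqP -> /eqP e]; rewrite -Ez !mem_shape e => /leq_trans; apply.
  by rewrite Es; apply: (cat_geq_lattice _ s2); rewrite -Es.
Qed.

End Shape.

(** * Walks of lattice words *)

(* [Insert]: a row whose point is inside the diagram; [Skip x]: a row whose point
   is outside, in column [x]; [Cut a]: the removal of a block of [a] columns with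
   no peak; [CutNone]: the removal of a column whose point is outside. *)
Inductive op := Insert | Skip of nat | Cut of nat | CutNone.

Definition width o := if o is Cut a then a else if o is CutNone then 1 else 0.
Definition wf_op o := if o is Cut a then 0 < a else true.

Definition cut_ok a (s : seq (option nat)) :=
  let t := drop (size s - a) s in [&& a <= size s, all isSome t & vshape (pmap id t)].

Definition cut_none_ok (s : seq (option nat)) :=
  (0 < size s) && (nth (Some 0) s (size s).-1 == None).

Section Walks.
Variable n : nat.
Notation box := ('I_n * 'I_n)%type.
Notation some := (map (fun i : 'I_n => Some (val i))).
Implicit Types (mu nu kappa : {set box}) (s t : seq (option nat)) (good : pred {set box}).

Definition choices good s :=
  [seq x <- iota 0 (size s) | (nth (Some 0) s x == None) && good (shape n (ins x s))].

(** Lists the words of columns, one letter per row, along which no operation fails. *)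
Fixpoint acc good ops s : seq (seq nat) :=
  if ops is o :: ops' then
    match o with
    | Insert => flatten [seq [seq x :: v | v <- acc good ops' (ins x s)] | x <- choices good s]
    | Skip x => [seq x :: v | v <- acc good ops' s]
    | Cut a => if cut_ok a s then acc good ops' (take (size s - a) s) else [::]
    | CutNone => if cut_none_ok s then acc good ops' (take (size s).-1 s) else [::]
    end
  else [:: [::]].

(** States are kept with multiplicity, one occurrence for each partial walk. *)
Definition next_states good o (S : seq (seq (option nat))) :=
  match o with
  | Insert => flatten [seq [seq ins x s | x <- choices good s] | s <- S]
  | Skip x => S
  | Cut a => [seq take (size s - a) s | s <- S & cut_ok a s]
  | CutNone => [seq take (size s).-1 s | s <- S & cut_none_ok s]
  end.

Definition total_acc good ops S := \sum_(s <- S) size (acc good ops s).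

Lemma total_acc_next good o ops S : total_acc good (o :: ops) S = total_acc good ops (next_states good o S).
Proof.
rewrite /total_acc; case: o => [|x|a|] /=.
- rewrite big_flatten /= big_map; apply: eq_bigr => s _.
  rewrite size_flatten sumnE !big_map; apply: eq_bigr => x _.
  by rewrite size_map.
- by apply: eq_bigr => s _; rewrite size_map.
- by rewrite big_map big_filter [RHS]big_mkcond; apply: eq_bigr => s _; case: ifP.
- by rewrite big_map big_filter [RHS]big_mkcond; apply: eq_bigr => s _; case: ifP.
Qed.

(* The factor [1/2] in the case of [Cut] comes from the two ways of splitting a
   V-shaped word into strips. *)
Definition gstep good o (g : {set box} -> nat) : {set box} -> nat :=
  match o with
  | Insert => fun nu =>
      if good nu then \sum_(b | (b \in nu) && ideal (nu :\ b)) g (nu :\ b) else 0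
  | Skip _ => g
  | Cut a => fun mu =>
      \sum_(nu | [&& ideal nu, mu \subset nu & #|nu :\: mu| == a]) (#|strips mu nu|)./2 * g nu
  | CutNone => g
  end.

Fixpoint geval good ops g : nat :=
  if ops is o :: ops' then geval good ops' (gstep good o g) else g set0.

(* The number of walks that lead to a given state only depends on its shape. *)
Definition counts c S (g : {set box} -> nat) :=
  (forall s, s \in S -> size s = c /\ lattice s) /\
  (forall s, size s = c -> lattice s -> count_mem s S = g (shape n s)).

Lemma shape_unins i s : lattice s -> size s <= n -> removable i s ->
  forall (lt_i : i < n) (lt_j : (cnt i s).-1 < n),
  shape n (unins i s).2 = shape n s :\ (Ordinal lt_i, Ordinal lt_j).
Proof.
move=> ls szs ri lt_i lt_j; have [U1 U2] := unins_lattice ls ri.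
apply/setP => -[i' j']; rewrite in_setD1 !mem_shape (cnt_unins i' U1).
rewrite xpair_eqE -!val_eqE /= negb_and.
have := cnt_unins i U1; rewrite eqxx.
have [->|] := eqVneq (i' : nat) i; last by rewrite addn0.
by move=> ->; rewrite /=; lia.
Qed.

Lemma sum_corners s (g : {set box} -> nat) : lattice s -> size s <= n ->
  \sum_(b | (b \in shape n s) && ideal (shape n s :\ b)) g (shape n s :\ b) =
  \sum_(i < n) (if removable i s then g (shape n (unins i s).2) else 0).
Proof.
move=> ls szs; set nu := shape n s.
rewrite (eq_bigr (fun b => g (nu :\ (b.1, b.2)))); last by case.
rewrite (eq_bigl (fun b => ((b.1, b.2) \in nu) && ideal (nu :\ (b.1, b.2)))); last by case.
rewrite -(pair_big_dep predT (fun i j => ((i, j) \in nu) && ideal (nu :\ (i, j)))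
  (fun i j => g (nu :\ (i, j)))) /=.
apply: eq_bigr => i _; case: ifPn => ri; last first.
  rewrite big_pred0 // => j; apply/negP => /andP[ijn /idealP[I1 I2]].
  move: ri; rewrite /removable -leqNgt => le_c.
  move: ijn; rewrite mem_shape => lt_j.
  have lt_i : i.+1 < n.
    apply: leq_trans szs; apply: lattice_cnt_size ls _.
    by apply: leq_trans le_c; apply: leq_ltn_trans lt_j.
  have adj : vadj (i, j) (Ordinal lt_i, j) by rewrite /vadj /= !eqxx.
  suff /(I2 _ _ adj) : (Ordinal lt_i, j) \in nu :\ (i, j) by rewrite in_setD1 eqxx.
  rewrite in_setD1 mem_shape /= (leq_trans lt_j le_c) andbT xpair_eqE -val_eqE /=.
  by rewrite eqxx andbT; lia.
have c0 : 0 < cnt i s by apply: leq_ltn_trans ri.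
have lt_j : (cnt i s).-1 < n.
  by rewrite prednK //; apply: leq_trans (cnt_size i s) szs.
have [U1 U2] := unins_lattice ls ri.
have E := shape_unins ls szs ri (ltn_ord i) lt_j.
have Ei : Ordinal (ltn_ord i) = i by apply: val_inj.
rewrite Ei in E.
rewrite (big_pred1 (Ordinal lt_j)) => [|j]; first by rewrite E.
apply/andP/eqP => [[ijn /idealP[I1 _]]|->]; last first.
  by rewrite mem_shape /= prednK // -E ideal_shape.
apply: val_inj; move: ijn; rewrite mem_shape /= => lt_jc.
apply/eqP; rewrite eqn_leq -ltnS prednK // lt_jc /= leqNgt; apply/negP => lt_jp.
have lt_jn : j.+1 < n by apply: leq_ltn_trans lt_jp lt_j.
have adj : hadj (i, j) (i, Ordinal lt_jn) by rewrite /hadj /= !eqxx.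
suff /(I1 _ _ adj) : (i, Ordinal lt_jn) \in nu :\ (i, j) by rewrite in_setD1 eqxx.
rewrite in_setD1 mem_shape /= -[X in _ < X](prednK c0) ltnS lt_jp andbT xpair_eqE -val_eqE /=.
by rewrite eqxx /= -val_eqE /=; lia.
Qed.

(** At most one insertion leads from [s] to [s'], and only the row where it ends leads back to [s];
    so both sides are 0 or 1. *)
Lemma count_choices good s s' : lattice s -> lattice s' -> size s' <= n -> size s = size s' ->
  good (shape n s') ->
  count_mem s' [seq ins x s | x <- choices good s] =
  \sum_(i < n) (unins i s' == (None, s)).
Proof.
move=> ls ls' sz' szE gs'.
rewrite count_map /choices count_filter.
pose ok x := (nth (Some 0) s x == None) && (ins x s == s').
have -> : count (predI (preim (ins^~ s) (pred1 s'))
    (fun x => (nth (Some 0) s x == None) && good (shape n (ins x s)))) (iota 0 (size s)) =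
    count ok (iota 0 (size s)).
  apply: eq_count => x; rewrite /ok /=; case: eqP => [->|]; last by rewrite andbF.
  by rewrite gs' /= !andbT.
have [/hasP[x]|no] := boolP (has ok (iota 0 (size s))).
  rewrite mem_iota /= add0n => lt_x /andP[/eqP Nx /eqP Ex].
  have -> : count ok (iota 0 (size s)) = 1.
    rewrite -(_ : count_mem x (iota 0 (size s)) = 1); last first.
      by rewrite count_uniq_mem ?iota_uniq // mem_iota /= add0n lt_x.
    apply: eq_in_count => y; rewrite mem_iota /= add0n => lt_y; rewrite /ok.
    apply/andP/eqP => [[/eqP Ny /eqP Ey]|->]; last by rewrite Nx Ex !eqxx.
    by apply: (@ins_inj_pos _ _ s) => //; rewrite Ey Ex.
  have lt_i : ins_row x s < n.
    apply: leq_trans sz'; apply: lattice_cnt_size ls' _.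
    by rewrite -Ex cnt_ins // eqxx addn1.
  rewrite (bigD1 (Ordinal lt_i)) //= -{1}Ex unins_ins // eqxx big1 // => i ni.
  apply/eqP; rewrite eqb0; apply/eqP => /unins_None [y [lt_y Ny Ey Ei]].
  move/eqP: ni; apply; apply: val_inj => /=.
  by rewrite -Ei (@ins_inj_pos y x s) // Ey Ex.
rewrite has_count -leqNgt leqn0 in no; rewrite (eqP no) big1 // => i _.
apply/eqP; rewrite eqb0; apply/eqP => /unins_None [y [lt_y Ny Ey Ei]].
move: no; rewrite -leqn0 leqNgt -has_count => /negP; apply; apply/hasP.
by exists y; rewrite ?mem_iota // /ok Ny Ey !eqxx.
Qed.

(** Each corner of the shape of [s'] gives, by reverse insertion, exactly one predecessor, whose
    shape lacks just this corner. So the multiplicity of [s'] depends on its shape only. *)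
Lemma counts_insert good c S g : c <= n -> counts c S g ->
  counts c (next_states good Insert S) (gstep good Insert g).
Proof.
move=> cn [HS Hg]; split=> [s /flattenP[_ /mapP[s0 /HS[sz0 l0] ->]]|s' sz' l'].
  case/mapP => x; rewrite mem_filter => /andP[/andP[/eqP Nx _] _] ->.
  by rewrite size_ins; split=> //; apply: lattice_ins.
rewrite /= count_flatten sumnE !big_map.
case: ifPn => gs; last first.
  rewrite big1_seq // => s /andP[_ sS]; apply/count_memPn/mapP => -[x].
  by rewrite mem_filter => /andP[/andP[_ gx] _] E; rewrite E gx in gs.
rewrite sum_corners ?sz' //.
rewrite (eq_big_seq (fun s => \sum_(i < n) (unins i s' == (None, s)))); last first.
  by move=> s /HS[szs ls]; apply: count_choices; rewrite ?sz' ?szs.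
rewrite exchange_big /=; apply: eq_bigr => i _.
have E : forall s, (unins i s' == (None, s)) = ((unins i s').1 == None) && ((unins i s').2 == s).
  by move=> s; rewrite -xpair_eqE -surjective_pairing.
under eq_bigr => s _ do rewrite E.
case: ifPn => ri.
  have [U1 U2] := unins_lattice l' ri; rewrite -Hg ?size_unins //.
  rewrite U1 eqxx /= -sum1_count [RHS]big_mkcond; apply: eq_bigr => s _ /=.
  by rewrite eq_sym; case: eqP.
rewrite big1_seq // => s /andP[_ /HS[szs ls]]; apply/eqP; rewrite eqb0.
apply: contra ri => /andP[/eqP U1 /eqP U2]; rewrite /removable.
have := cnt_unins i U1; have := cnt_unins i.+1 U1; rewrite U2 eqxx => -> ->.
have := ls (size s) i; rewrite take_size; case: eqP; lia.
Qed.

Lemma someE (z : seq 'I_n) : some z = map Some (map val z).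
Proof. by rewrite -map_comp. Qed.

Lemma map_Some_pmap t : all isSome t -> map Some (pmap id t) = t.
Proof. by elim: t => [|[i|] t IH] //= /IH ->. Qed.

Lemma pmap_some (z : seq 'I_n) : pmap id (some z) = map val z.
Proof. by elim: z => //= i z ->. Qed.

Lemma some_of s t : lattice (s ++ t) -> size (s ++ t) <= n -> all isSome t ->
  exists z : seq 'I_n, t = some z.
Proof.
move=> ls sz al.
have [z Ez] : exists z : seq 'I_n, map val z = pmap id t.
  apply: seq_ord; apply/allP => i it; apply: leq_trans sz; apply: lattice_cnt_size ls _.
  rewrite cnt_cat -(map_Some_pmap al) cnt_map addn_gt0; apply/orP; right.
  by rewrite -has_count has_pred1.
by exists z; rewrite someE Ez map_Some_pmap.
Qed.

Lemma some_inj : injective (fun z : seq 'I_n => some z).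
Proof. by apply: inj_map => i j [] /val_inj. Qed.

Lemma card_shape_cat s (z : seq 'I_n) : lattice s -> lattice (s ++ some z) ->
  size (s ++ some z) <= n -> #|shape n (s ++ some z) :\: shape n s| = size z.
Proof.
move=> ls lsz sz; set A := _ :\: _.
have szs : size s <= n by apply: leq_trans sz; rewrite size_cat leq_addr.
rewrite cardE -(size_map (fun b : box => val b.1)) -(size_map val z).
apply: perm_size.
have H (i : 'I_n) : count_mem (val i) [seq val b.1 | b <- enum A] = count_mem (val i) (map val z).
  rewrite count_rows; have sub : shape n s \subset shape n (s ++ some z).
    by apply/subsetP => -[i' j]; rewrite !mem_shape cnt_cat => /leq_trans; apply; apply: leq_addr.
  have := rowlenD i sub; rewrite -/A !rowlen_shape // cnt_cat someE cnt_map.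
  by move=> /addnI.
by apply/allP => x; rewrite mem_cat => /orP[] /mapP[b _ ->]; apply/eqP; apply: H.
Qed.

(** The predecessors of [s] are its extensions by a V-shaped block. Those of shape [nu] all have
    multiplicity [g nu], and there are half as many of them as intermediate shapes. *)
Lemma counts_cut good c a S g : c + a <= n -> 0 < a -> counts (c + a) S g ->
  counts c (next_states good (Cut a) S) (gstep good (Cut a) g).
Proof.
move=> can a0 [HS Hg]; split=> [s /mapP[s0]|s sz ls].
  rewrite mem_filter => /andP[_ /HS[sz0 l0]] ->; rewrite sz0 addnK; split.
    by rewrite size_takel // sz0 leq_addr.
  exact: lattice_take.
rewrite /= count_map count_filter.
set P := predI _ _.
have -> : count P S = \sum_nu count (fun t => P t && (shape n t == nu)) S.
  rewrite -sum1_count (partition_big (shape n) predT) //=.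
  by apply: eq_bigr => nu _; rewrite sum1_count.
rewrite [RHS]big_mkcond; apply: eq_bigr => nu _.
have PE t : t \in S -> P t -> exists z : a.-tuple 'I_n,
    [/\ t = s ++ some z, vshape (map val z), lattice t & size t = c + a].
  move=> /HS[szt lt] /andP[/eqP E /and3P[_ al vs]].
  rewrite szt addnK in E al vs; have Et : t = s ++ drop c t by rewrite -E cat_take_drop.
  have [z Ez] : exists z : seq 'I_n, drop c t = some z.
    by apply: (@some_of s); rewrite -?Et ?szt.
  have szz : size z == a by rewrite -(size_map (fun i : 'I_n => Some (val i))) -Ez size_drop szt addKn.
  exists (Tuple szz); split=> //=; first by rewrite -Ez.
  by rewrite -pmap_some -Ez.
case: ifPn => [/and3P[inu sub /eqP card_nu]|Q]; last first.
  apply/eqP; rewrite -leqn0 leqNgt -has_count; apply/negP => /hasP[t tS /andP[Pt /eqP Et]].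
  case/negP: Q; have [z [Ez vz lt szt]] := PE t tS Pt.
  rewrite -Et ideal_shape //= Ez card_shape_cat -?Ez ?szt // size_tuple eqxx andbT.
  by apply/subsetP => -[i j]; rewrite !mem_shape Ez cnt_cat => /leq_trans; apply; apply: leq_addr.
have <- : #|vblocks s a nu| = (#|strips (shape n s) nu|)./2.
  by rewrite -(card_vblocks ls _ a0 inu card_nu) ?sz // muln2 doubleK.
rewrite -sum_nat_const.
rewrite (eq_bigr (fun z : a.-tuple 'I_n => count_mem (s ++ some z) S)); last first.
  move=> z; rewrite inE => /and3P[_ /asboolP lz /eqP <-].
  by rewrite Hg // size_cat size_map size_tuple sz.
under [RHS]eq_bigr => z _ do rewrite -sum1_count big_mkcond.
rewrite exchange_big /= -sum1_count big_mkcond /=; apply: eq_big_seq => t tS.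
case: ifPn => [/andP[Pt /eqP Et]|nP].
  have [z [Ez vz lt szt]] := PE t tS Pt.
  rewrite (bigD1 z) /=; last first.
    by rewrite inE vz -Ez Et eqxx andbT; apply/asboolP.
  rewrite Ez eqxx big1 // => z' /andP[_ nz]; case: eqP => // /eqP.
  rewrite eqseq_cat // eqxx /= => /eqP/some_inj/val_inj E.
  by rewrite E eqxx in nz.
rewrite big1 // => z; rewrite inE => /and3P[vz /asboolP lz /eqP Ez]; case: eqP => // Et.
have [szt lt] := HS t tS; case/negP: nP; rewrite Et Ez eqxx andbT /P /= /cut_ok.
rewrite -Et szt addnK leq_addl Et -{1 2 3}sz take_size_cat // drop_size_cat // eqxx /=.
by rewrite pmap_some vz andbT all_map; apply/allP.
Qed.

Lemma counts_cut_none good c S g : c.+1 <= n -> counts c.+1 S g ->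
  counts c (next_states good CutNone S) (gstep good CutNone g).
Proof.
move=> cn [HS Hg]; split=> [s /mapP[s0]|s sz ls].
  rewrite mem_filter => /andP[_ /HS[sz0 l0]] ->; rewrite sz0; split.
    by rewrite size_takel // sz0.
  exact: lattice_take.
have cntN i : cnt i (rcons s None) = cnt i s by rewrite cnt_rcons addn0.
have lN : lattice (rcons s None).
  apply/lattice_rcons; split=> // i; rewrite !cntN.
  by have := ls (size s) i; rewrite take_size.
rewrite [RHS](_ : _ = g (shape n (rcons s None))); last first.
  by congr g; apply/setP => -[i j]; rewrite !mem_shape cntN.
rewrite -Hg ?size_rcons ?sz //= count_map count_filter.
apply: eq_in_count => t /HS[szt lt]; rewrite /= /cut_none_ok szt /=.
apply/andP/eqP => [[/eqP E1 /eqP E2]|->]; last first.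
  by rewrite nth_rcons sz ltnn eqxx -cats1 take_size_cat.
by rewrite -[t]take_size szt (take_nth (Some 0)) ?szt // E1 E2.
Qed.

Lemma total_acc_geval good ops c S g : c <= n -> counts c S g -> all wf_op ops ->
  sumn (map width ops) = c -> total_acc good ops S = geval good ops g.
Proof.
elim: ops c S g => [|o ops IH] c S g cn Cg /=.
  move=> _ c0; subst c; case: Cg => HS Hg; rewrite /total_acc sum1_size.
  have -> : set0 = shape n [::] by apply/setP => b; rewrite !inE.
  rewrite -Hg // -count_predT; apply: eq_in_count => s /HS[/size0nil -> _].
  by [].
move=> /andP[wo wops] E; rewrite total_acc_next.
have cn' : sumn (map width ops) <= n by apply: leq_trans cn; rewrite -E leq_addl.
apply: (IH _ _ _ cn') => //; subst c; move: wo cn Cg; case: o => [|x|a|] /= wo cn Cg.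
- exact: counts_insert.
- by [].
- by apply: counts_cut => //; rewrite addnC.
- by apply: counts_cut_none.
Qed.

Lemma gstep_transpose good good' o g g' :
  (forall nu, ideal nu -> good' (transpose nu) = good nu) ->
  (forall nu, ideal nu -> g' (transpose nu) = g nu) ->
  forall nu, ideal nu -> gstep good' o g' (transpose nu) = gstep good o g nu.
Proof.
move=> Hgood Hg nu inu; case: o => [|x|a|] /=; try exact: Hg.
  rewrite Hgood //; case: ifP => // _.
  rewrite (reindex_inj (can_inj (@swapK n))) /=.
  have E b : transpose nu :\ swap b = transpose (nu :\ b).
    by apply/setP=> c; rewrite !inE (can2_eq (@swapK n) (@swapK n)).
  apply: eq_big => b.
    by rewrite E ideal_transpose inE swapK.
  by case/andP=> _; rewrite E ideal_transpose => /Hg.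
rewrite (reindex_inj (can_inj (@transposeK n))) /=.
have ED mu : transpose mu :\: transpose nu = transpose (mu :\: nu).
  by apply/setP=> c; rewrite !inE.
apply: eq_big => mu.
  by rewrite ideal_transpose subset_transpose ED card_transpose.
rewrite ideal_transpose subset_transpose => /and3P[imu sub _].
by rewrite card_strips_transpose // Hg.
Qed.

Lemma geval_transpose good good' ops g g' :
  (forall nu, ideal nu -> good' (transpose nu) = good nu) ->
  (forall nu, ideal nu -> g' (transpose nu) = g nu) ->
  geval good' ops g' = geval good ops g.
Proof.
move=> Hgood; elim: ops g g' => [|o ops IH] g g' Hg /=.
  have E : transpose set0 = set0 :> {set box} by apply/setP => b; rewrite !inE.
  by rewrite -{1}E Hg //; apply/idealP; split=> b b' _; rewrite inE.
by apply: IH; apply: gstep_transpose.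
Qed.

(** Corners, cardinalities and strip counts are invariant under transposition, so in the evaluation
    on shapes only the predicate [good] changes. *)
Theorem card_acc_transpose good good' ops : all wf_op ops -> sumn (map width ops) = n ->
  (forall nu, ideal nu -> good' (transpose nu) = good nu) ->
  size (acc good' ops (nseq n None)) = size (acc good ops (nseq n None)).
Proof.
move=> wops Ew Hgood; pose g nu := (nu == set0 :> {set box}) : nat.
have cntN i : cnt i (nseq n None) = 0 by rewrite /cnt count_nseq.
have C : counts n [:: nseq n None] g.
  split=> [s|s sz ls].
    by rewrite inE => /eqP ->; rewrite size_nseq; split=> //; apply: lattice_nseq.
  rewrite /= addn0 /g; congr nat_of_bool; apply/eqP/eqP => [<-|E].
    by apply/setP => -[i j]; rewrite mem_shape cntN inE.
  have : all (pred1 None) s.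
    apply/allP => -[i|] //= si; exfalso.
    have c0 : 0 < cnt i s by rewrite /cnt -has_count has_pred1.
    have lt_i : i < n by rewrite -sz; apply: lattice_cnt_size ls c0.
    have lt_0 : 0 < n by apply: leq_ltn_trans lt_i.
    have : (Ordinal lt_i, Ordinal lt_0) \in shape n s by rewrite mem_shape.
    by rewrite E inE.
  by move/all_pred1P => ->; rewrite sz.
have tot gd : total_acc gd ops [:: nseq n None] = size (acc gd ops (nseq n None)).
  by rewrite /total_acc big_seq1.
rewrite -!tot !(@total_acc_geval _ _ n _ g) //.
apply: geval_transpose => // nu _; congr nat_of_bool.
have E : transpose set0 = set0 :> {set box} by apply/setP => b; rewrite !inE.
by rewrite -{1}E (inj_eq (can_inj (@transposeK n))).
Qed.

End Walks.

(** * Insertion tableaux of words *)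

Definition tab N (w : seq nat) := foldl (fun s x => ins x s) (nseq N None) w.

Lemma tab_rcons N w x : tab N (rcons w x) = ins x (tab N w).
Proof. by rewrite /tab foldl_rcons. Qed.

Lemma size_tab N w : size (tab N w) = N.
Proof. by elim/last_ind: w => [|w x IH]; rewrite ?size_nseq // tab_rcons size_ins. Qed.

Lemma nth_bump_None d k s y : (nth (Some d) (bump k s) y == None) = (nth (Some d) s y == None).
Proof. by elim: s k y => [|a s IH] k [|y] //=; case: (a =P Some k) => [E|_] //=; rewrite ?IH ?E. Qed.

Lemma nth_ins_None d x s y :
  (nth (Some d) (ins x s) y == None) = (nth (Some d) s y == None) && (y != x).
Proof.
elim: s x y => [|a s IH] [|x] [|y] //=; rewrite ?andbF ?andbT ?nth_bump_None //.
by rewrite IH.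
Qed.

Lemma nth_tab_None N w y : y < N -> (nth (Some 0) (tab N w) y == None) = (y \notin w).
Proof.
move=> lt_y; elim/last_ind: w => [|w x IH]; first by rewrite nth_nseq lt_y.
by rewrite tab_rcons nth_ins_None IH mem_rcons inE negb_or andbC.
Qed.

Lemma lattice_tab N w : uniq w -> all (fun x => x < N) w -> lattice (tab N w).
Proof.
elim/last_ind: w => [|w x IH]; first by move=> _ _; apply: lattice_nseq.
rewrite rcons_uniq all_rcons tab_rcons => /andP[xw uw] /andP[lt_x lt_w].
by apply: lattice_ins; [apply/eqP; rewrite nth_tab_None | apply: IH].
Qed.

(** Thanks to this, the state after a cut is still the tableau of a word. *)
Lemma take_tab c N w : c <= N -> take c (tab N w) = tab c [seq x <- w | x < c].
Proof.
move=> cN; elim/last_ind: w => [|w x IH]; first by rewrite /= take_nseq.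
rewrite tab_rcons filter_rcons; case: ltnP => [lt_x|le_x].
  by rewrite take_ins_lt // IH tab_rcons.
by rewrite take_ins_ge.
Qed.

(** * Schensted's theorem for chains on one side of a given column *)

Definition has_chain (r : rel nat) k (w : seq nat) (p : pred nat) :=
  exists s, [/\ subseq s w, sorted r s, size s = k & all p s].

Lemma subseq_rconsP (s w : seq nat) x :
  subseq s (rcons w x) -> subseq s w \/ exists2 s', s = rcons s' x & subseq s' w.
Proof.
rewrite -subseq_rev rev_rcons; case: (lastP s) => [|s' y]; first by left; apply: sub0seq.
rewrite rev_rcons /=; case: eqP => [->|_]; first by right; exists s' => //; rewrite -subseq_rev.
by rewrite -[y :: rev s']rev_rcons subseq_rev; left.
Qed.

Lemma subseq_rcons_l (s w : seq nat) x : subseq s w -> subseq s (rcons w x).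
Proof. by move=> sw; apply: subseq_trans sw _; apply: subseq_rcons. Qed.

Lemma subseq_rcons2 (s w : seq nat) x : subseq s w -> subseq (rcons s x) (rcons w x).
Proof. by move=> sw; rewrite -!cats1; apply: cat_subseq. Qed.

Lemma gtn_trans : transitive gtn.
Proof. by move=> x y z /= xy yz; apply: ltn_trans yz xy. Qed.

(** Both sides obey the same recursion: a new last letter [x >= a] prolongs the decreasing chains
    whose letters are at least [x.+1]. *)
Lemma dec_chainP N w k a : uniq w -> all (fun x => x < N) w ->
  has_chain gtn k w (fun x => a <= x) <-> k <= lis 0 (drop a (tab N w)).
Proof.
elim/last_ind: w k a => [|w x IH] k a.
  move=> _ _; have -> : lis 0 (drop a (tab N [::])) = 0.
    rewrite drop_nseq; elim: (N - a) => //.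
  split=> [[s []]|]; first by rewrite subseq0 => /eqP -> _ <-.
  by rewrite leqn0 => /eqP ->; exists [::].
rewrite rcons_uniq all_rcons => /andP[xw uw] /andP[lt_x lt_w].
have {}IH k' a' := IH k' a' uw lt_w.
rewrite tab_rcons lis_drop_ins ?size_tab //; last by apply/eqP; rewrite nth_tab_None.
split=> [[s [sub so sz al]]|].
  case: (subseq_rconsP sub) => [sub'|[s' Es sub']].
    have le1 : k <= lis 0 (drop a (tab N w)) by apply/IH; exists s.
    by case: ifP => _; rewrite // leq_max le1.
  subst s; move: al so; rewrite all_rcons => /andP[-> al] so.
  have : size s' <= lis 0 (drop x.+1 (tab N w)).
    by apply/IH; move: so; rewrite (sorted_pairwise gtn_trans) pairwise_rcons -(sorted_pairwise gtn_trans) => /andP[al' so]; exists s'.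
  by rewrite -sz size_rcons leq_max ltnS => ->; rewrite orbT.
case: (leqP a x) => [le_ax|_ /IH[s [sub so sz al]]]; last by exists s; rewrite subseq_rcons_l.
rewrite leq_max => /orP[/IH[s [sub so sz al]]|]; first by exists s; rewrite subseq_rcons_l.
case: k => [|k]; first by exists [::]; rewrite sub0seq.
rewrite ltnS => /IH[s [sub so sz al]]; exists (rcons s x); split.
- exact: subseq_rcons2.
- move: so; rewrite !(sorted_pairwise gtn_trans) pairwise_rcons => ->.
  by rewrite andbT.
- by rewrite size_rcons sz.
rewrite all_rcons le_ax; apply: sub_all al => y lt_y.
by apply: leq_trans le_ax (ltnW lt_y).
Qed.

Lemma final_row_eq0 s : (0 == final_row 0 s) = (cnt 0 s == 0).
Proof.
have ge k t : k <= final_row k t.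
  elim: t k => //= b t IH k; apply: leq_trans (IH _); case: ifP => //.
elim: s => [|a s IH] //=; rewrite cnt_cons; case: (a =P Some 0) => _; last exact: IH.
by have := ge 1 s; case: (final_row 1 s).
Qed.

Lemma cnt0_ins x s : x < size s -> nth (Some 0) s x = None ->
  cnt 0 (ins x s) = maxn (cnt 0 s) (cnt 0 (take x s)).+1.
Proof.
move=> lt_x Nx; rewrite cnt_ins // /ins_row final_row_eq0.
have -> : cnt 0 s = cnt 0 (take x s) + cnt 0 (drop x.+1 s).
  by rewrite -{1}(cat_take_drop x s) (drop_nth (Some 0)) // Nx cnt_cat.
by case: eqP; lia.
Qed.

(** Here row 0 suffices: a new last letter [x] prolongs the increasing chains below [x], and the
    entries of row 0 left of [x] count the longest of these. *)
Lemma inc_chainP N w k a : uniq w -> all (fun x => x < N) w ->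
  has_chain ltn k w (fun x => x < a) <-> k <= cnt 0 (take a (tab N w)).
Proof.
elim/last_ind: w k a => [|w x IH] k a.
  move=> _ _; have -> : cnt 0 (take a (tab N [::])) = 0.
    by apply/eqP; rewrite -leqn0; have := @lattice_nseq N; rewrite /tab /= /cnt;
       elim: N a => [|N IH] [|a] //= l; apply: IH => q i; apply: lattice_nseq.
  split=> [[s []]|]; first by rewrite subseq0 => /eqP -> _ <-.
  by rewrite leqn0 => /eqP ->; exists [::].
rewrite rcons_uniq all_rcons => /andP[xw uw] /andP[lt_x lt_w].
have {}IH k' a' := IH k' a' uw lt_w.
have Nx : nth (Some 0) (tab N w) x = None by apply/eqP; rewrite nth_tab_None.
have -> : cnt 0 (take a (tab N (rcons w x))) =
  if x < a then maxn (cnt 0 (take a (tab N w))) (cnt 0 (take x (tab N w))).+1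
  else cnt 0 (take a (tab N w)).
  rewrite tab_rcons; case: ltnP => [lt_xa|]; last by move/take_ins_ge ->.
  rewrite take_ins_lt // cnt0_ins ?nth_take // ?take_takel ?(ltnW lt_xa) //.
  by rewrite size_take size_tab; case: ifP.
split=> [[s [sub so sz al]]|].
  case: (subseq_rconsP sub) => [sub'|[s' Es sub']].
    have le1 : k <= cnt 0 (take a (tab N w)) by apply/IH; exists s.
    by case: ifP => _; rewrite // leq_max le1.
  subst s; move: al so; rewrite all_rcons => /andP[-> al] so.
  have : size s' <= cnt 0 (take x (tab N w)).
    by apply/IH; move: so; rewrite (sorted_pairwise ltn_trans) pairwise_rcons -(sorted_pairwise ltn_trans) => /andP[al' so]; exists s'.
  by rewrite -sz size_rcons leq_max ltnS => ->; rewrite orbT.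
case: (ltnP x a) => [lt_xa|_ /IH[s [sub so sz al]]]; last by exists s; rewrite subseq_rcons_l.
rewrite leq_max => /orP[/IH[s [sub so sz al]]|]; first by exists s; rewrite subseq_rcons_l.
case: k => [|k]; first by exists [::]; rewrite sub0seq.
rewrite ltnS => /IH[s [sub so sz al]]; exists (rcons s x); split.
- exact: subseq_rcons2.
- move: so; rewrite !(sorted_pairwise ltn_trans) pairwise_rcons => ->.
  by rewrite andbT.
- by rewrite size_rcons sz.
rewrite all_rcons lt_xa; apply: sub_all al => y lt_y.
by apply: ltn_trans lt_y lt_xa.
Qed.

Lemma bump_adjacent k s i a b : nth None s i = Some a -> nth None s i.+1 = Some b ->
  exists a' b', [/\ nth None (bump k s) i = Some a', nth None (bump k s) i.+1 = Some b'
    & (b' <= a') = (b <= a)].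
Proof.
elim: s k i => [|c s IH] k [|i] //=; last by move=> Ha Hb; case: ifP => _; apply: IH.
move=> ->; case: s {IH} => // d s /= ->; rewrite !eq_Some.
case: (a =P k) => [->|nak] /=; rewrite ?eq_Some.
  case: (b =P k.+1) => [->|nbk] /=; first by exists k.+1, k.+2; split=> //; lia.
  by exists k.+1, b; split=> //; lia.
case: (b =P k) => [->|nbk] /=; last by exists a, b.
by exists a, k.+1; split=> //; lia.
Qed.

(** The relation is settled when the second of the two columns is inserted. It enters row 0, and if
    it is [i] while [i.+1] lies in row 0, then [i.+1] is the entry it bumps. Later bumping preserves
    the relation. *)
Lemma tab_adjacent N w i : uniq w -> all (fun x => x < N) w -> i \in w -> i.+1 \in w ->
  exists a b, [/\ nth None (tab N w) i = Some a, nth None (tab N w) i.+1 = Some b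
    & (b <= a) = (index i w < index i.+1 w)].
Proof.
elim/last_ind: w => [|w x IH] //.
rewrite rcons_uniq all_rcons => /andP[xw uw] /andP[lt_x lt_w] iw i1w.
have isS y : y \in w -> exists c, nth None (tab N w) y = Some c.
  move=> yw; have lt_y : y < N by apply: (allP lt_w).
  have := nth_tab_None w lt_y; rewrite yw /= (set_nth_default None) ?size_tab //.
  by case: (nth _ _ _) => // c; exists c.
have Nx : nth None (tab N w) x = None.
  by have := nth_tab_None w lt_x; rewrite xw (set_nth_default None) ?size_tab // => /eqP.
have idx y : y \in w -> index y (rcons w x) = index y w.
  by move=> yw; rewrite -cats1 index_cat yw.
have idxx : index x (rcons w x) = size w.
  by rewrite -cats1 index_cat (negPf xw) /= eqxx addn0.
have E : tab N (rcons w x) = take x (tab N w) ++ Some 0 :: bump 0 (drop x.+1 (tab N w)).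
  by rewrite tab_rcons insE // size_tab.
have szt : size (take x (tab N w)) = x by rewrite size_takel // size_tab ltnW.
have nth_lt y : y < x -> nth None (tab N (rcons w x)) y = nth None (tab N w) y.
  by move=> lt_yx; rewrite E nth_cat szt lt_yx nth_take.
have nth_eq : nth None (tab N (rcons w x)) x = Some 0.
  by rewrite E nth_cat szt ltnn subnn.
have nth_gt y : x < y -> nth None (tab N (rcons w x)) y = nth None (bump 0 (drop x.+1 (tab N w))) (y - x.+1).
  move=> lt_xy; rewrite E nth_cat szt ltnNge (ltnW lt_xy) /=.
  by rewrite -[y - x]prednK ?subn_gt0 // subnS.
move: iw i1w; rewrite !mem_rcons !inE.
case: (ltngtP i x) => [lt_ix|lt_xi|E1] /= iw.
- case: (ltngtP i.+1 x) => [lt_i1x|lt_xi1|E2] /= i1w.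
  + rewrite !nth_lt // !idx //; exact: IH.
  + by have := leq_trans lt_xi1 lt_ix; rewrite ltnn.
  + have [c Ec] := isS i iw; rewrite nth_lt // Ec E2 nth_eq idxx idx //.
    by exists c, 0; rewrite index_mem iw.
- rewrite [i.+1 == x]gtn_eqF ?(leqW lt_xi) //= => i1w.
  rewrite !nth_gt ?(leqW lt_xi) // !idx // subSn //.
  have [a [b [Ea Eb <-]]] := IH uw lt_w iw i1w.
  by apply: bump_adjacent; rewrite nth_drop ?addnS subnKC.
- subst x; rewrite gtn_eqF //= => i1w.
  have [c Ec] := isS _ i1w; rewrite nth_eq nth_gt // subnn idxx idx //.
  have : exists c', nth None (bump 0 (drop i.+1 (tab N w))) 0 = Some c'.+1.
    have lt_i1 : i.+1 < size (tab N w) by rewrite size_tab; apply: (allP lt_w).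
    rewrite (drop_nth None) //= Ec eq_Some; case: (c =P 0) => [_|c0] /=; first by exists 0.
    by case: c Ec c0 => // c Ec _; exists c.
  case=> c' ->; exists 0, c'.+1; split=> //=.
  by rewrite [RHS]ltnNge index_size.
Qed.

(** * Accepted words *)

Definition is_letter o := if o is (Insert | Skip _) then true else false.

Section Run.
Variable n : nat.
Notation box := ('I_n * 'I_n)%type.
Implicit Types (good : pred {set box}) (s : seq (option nat)).

Fixpoint run good ops (v : seq nat) s : bool :=
  if ops is o :: ops' then
    match o with
    | Insert => if v is x :: v' then
        [&& x < size s, nth (Some 0) s x == None, good (shape n (ins x s))
          & run good ops' v' (ins x s)] else false
    | Skip y => if v is x :: v' then (x == y) && run good ops' v' s else false
    | Cut a => cut_ok a s && run good ops' v (take (size s - a) s)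
    | CutNone => cut_none_ok s && run good ops' v (take (size s).-1 s)
    end
  else v == [::].

Lemma mem_acc good ops v s : (v \in acc good ops s) = run good ops v s.
Proof.
elim: ops v s => [|[|y|a|] ops IH] v s /=; first by rewrite inE.
- apply/flattenP/idP => [[_ /mapP[x + ->] /mapP[v' + ->]]|].
    rewrite IH mem_filter mem_iota => /andP[/andP[-> ->] /andP[_ lt_x]] ->.
    by rewrite lt_x.
  case: v => // x v /and4P[lt_x Nx gx]; rewrite -IH => va.
  exists [seq x :: v' | v' <- acc good ops (ins x s)]; last exact: map_f.
  by apply: (map_f (fun x => [seq x :: v' | v' <- acc good ops (ins x s)]));
     rewrite mem_filter Nx gx mem_iota.
- apply/mapP/idP => [[v' + ->]|]; first by rewrite IH eqxx.
  by case: v => // x v /andP[/eqP -> rv]; exists v; rewrite ?IH.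
- by case: ifP => //=; rewrite IH.
- by case: ifP => //=; rewrite IH.
Qed.

Lemma size_run good ops v s : run good ops v s -> size v = count is_letter ops.
Proof.
elim: ops v s => [|[|y|a|] ops IH] v s /=; first by move/eqP->.
- by case: v => // x v /and4P[_ _ _ /IH /= ->].
- by case: v => // x v /andP[_ /IH /= ->].
- by case/andP=> _ /IH ->.
- by case/andP=> _ /IH ->.
Qed.

Lemma uniq_acc good ops s : uniq (acc good ops s).
Proof.
elim: ops s => [|[|y|a|] ops IH] s //=; last 2 first.
- by case: ifP.
- by case: ifP.
- have: uniq (choices good s) by rewrite filter_uniq ?iota_uniq.
  elim: (choices good s) => //= x t IHt /andP[xt ut].
  rewrite cat_uniq map_inj_uniq ?IH ?IHt // => [|? ? []//].
  rewrite andbT; apply/hasPn => v /flattenP[_ /mapP[y yt ->]] /mapP[v' _ ->].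
  by apply/mapP => -[v'' _ [E _]]; rewrite E in yt; rewrite yt in xt.
- by rewrite map_inj_uniq // => ? ? [].
Qed.

(* The rows of the tableau weakly decrease from column [i] to column [i.+1] iff
   the permutation ascends there, so the second clause forbids peaks. *)
Definition cut_cond (incol link : pred nat) lo hi s :=
  (forall i, lo <= i < hi -> isSome (nth None s i) = incol i) /\
  (forall i, lo <= i -> i.+2 < hi -> link i -> link i.+1 ->
     odflt 0 (nth None s i.+1) <= odflt 0 (nth None s i) ->
     odflt 0 (nth None s i.+2) <= odflt 0 (nth None s i.+1)).

Lemma nth_pmap (t : seq (option nat)) j : all isSome t ->
  nth 0 (pmap id t) j = odflt 0 (nth None t j).
Proof. by elim: t j => [|[i|] t IH] [|j] //= al; apply: IH. Qed.

Lemma size_pmap_id (t : seq (option nat)) : all isSome t -> size (pmap id t) = size t.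
Proof. by elim: t => [|[i|] t IH] //= /IH ->. Qed.

Lemma cut_okP a c s : size s = n -> c + a <= n ->
  reflect ((forall i, c <= i < c + a -> isSome (nth None s i)) /\
    (forall i, c <= i -> i.+2 < c + a ->
     odflt 0 (nth None s i.+1) <= odflt 0 (nth None s i) ->
     odflt 0 (nth None s i.+2) <= odflt 0 (nth None s i.+1)))
   (cut_ok a (take (c + a) s)).
Proof.
move=> sz can; have szt : size (take (c + a) s) = c + a by rewrite size_takel ?sz.
rewrite /cut_ok szt leq_addl addnK /=.
set t := drop c _; have szdt : size t = a by rewrite size_drop szt addKn.
have ntht j : j < a -> nth None t j = nth None s (c + j).
  by move=> lt_j; rewrite nth_drop nth_take // ltn_add2l.
have alP : reflect (forall i, c <= i < c + a -> isSome (nth None s i)) (all isSome t).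
  apply: (iffP (all_nthP None)) => H i.
    move=> /andP[ci ia]; rewrite -(subnKC ci) -ntht; last by rewrite ltn_subLR.
    by apply: H; rewrite szdt ltn_subLR.
  by rewrite szdt => lt_i; rewrite ntht //; apply: H; rewrite leq_addr ltn_add2l.
apply: (iffP andP) => [[/[dup] al /alP H1 /vshapeP H2]|[/alP al H2]]; split=> //.
  move=> i ci lt_i; have [j Ej] : exists j, i = c + j by exists (i - c); rewrite subnKC.
  subst i; have lt_j : j.+2 < a by rewrite -(ltn_add2l c) !addnS.
  have := H2 j; rewrite size_pmap_id // szdt !nth_pmap // !ntht ?(ltnW lt_j) ?(ltnW (ltnW lt_j)) //.
  by rewrite !addnS; apply.
apply/vshapeP => j; rewrite size_pmap_id // szdt => lt_j.
rewrite !nth_pmap // !ntht ?(ltnW lt_j) ?(ltnW (ltnW lt_j)) // !addnS.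
by apply: H2; lia.
Qed.

(** From the right, an outside column is cut alone and a maximal run of linked columns at once. The
    operations are chosen before [good], [v] and [s], so one list serves both patterns. *)
Lemma cuts_exist (incol link : pred nat) lo hi : lo <= hi -> hi <= n ->
  (forall i, link i -> incol i && incol i.+1) ->
  exists ops0, [/\ all wf_op ops0, sumn (map width ops0) = hi - lo,
    count is_letter ops0 = 0 &
    forall good ops v s, size s = n ->
      run good (ops0 ++ ops) v (take hi s) <->
      cut_cond incol link lo hi s /\ run good ops v (take lo s)].
Proof.
move=> + + linkI; have [d] := ubnP (hi - lo); elim: d hi => // d IH hi lt_d le_lo le_n.
move: le_lo; rewrite leq_eqVlt => /orP[/eqP <-|lt_lo].
  exists [::]; rewrite subnn; split=> // good ops v s _; split=> [r|[]//].
  by split=> //; split=> i; lia.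
have [ci|ci] := boolP (incol hi.-1); last first.
  have [|||ops0 [w0 s0 l0 H0]] := IH hi.-1; try lia.
  exists (CutNone :: ops0); split=> //=; first by rewrite s0; lia.
  move=> good ops v s sz; have szt : size (take hi s) = hi by rewrite size_takel ?sz.
  rewrite /cut_none_ok szt (leq_ltn_trans _ lt_lo) //= take_takel ?leq_pred //.
  have hiK : hi.-1.+1 = hi by rewrite prednK // (leq_ltn_trans _ lt_lo).
  rewrite nth_take ?hiK // (set_nth_default None) ?sz; last by lia.
  have E : (nth None s hi.-1 == None) = (isSome (nth None s hi.-1) == incol hi.-1).
    by rewrite (negPf ci); case: (nth None s hi.-1).
  split=> [/andP[N /(H0 _ _ _ _ sz)[[c1 c2] r]]|[[c1 c2] r]].
    split=> //; split=> [i /andP[li ih]|i li ih l1 l2].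
      have [->|ne] := eqVneq i hi.-1; first by apply/eqP; rewrite -E.
      by apply: c1; lia.
    apply: c2 => //; have := linkI _ l2; case: (eqVneq i.+2 hi.-1) => [-> /andP[_]|]; last by lia.
    by rewrite (negPf ci).
  rewrite E c1 ?eqxx /=; last by lia.
  apply/(H0 _ _ _ _ sz); split=> //; split=> [i|i] li *; first by apply: c1; lia.
  by apply: c2 => //; lia.
(* The least such [a] is the length of the maximal linked run that ends at [hi.-1] and does not pass
   [lo]. *)
have [a [a0 ale aI aL]] : exists a, [/\ 0 < a, a <= hi - lo,
    forall i, hi - a <= i -> i.+1 < hi -> link i & hi - a = lo \/ ~~ link (hi - a).-1].
  have : exists a, (0 < a) && ((a == hi - lo) || ~~ link (hi - a).-1).
    by exists (hi - lo); rewrite eqxx subn_gt0 lt_lo.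
  case/ex_minnP => a /andP[a0 aP] amin.
  have ale : a <= hi - lo by apply: amin; rewrite eqxx subn_gt0 lt_lo.
  exists a; split=> //.
    move=> i li ih; apply/negPn/negP => nl.
    have : a <= hi - i.+1 by apply: amin; rewrite subn_gt0 ih subKn ?nl ?orbT // ltnW.
    by lia.
  by case/orP: aP => [/eqP ->|->]; [left; lia | right].
have [|||ops0 [w0 s0 l0 H0]] := IH (hi - a); try lia.
exists (Cut a :: ops0); split=> //=; [by rewrite a0 | by rewrite s0; lia |].
move=> good ops v s sz; have szt : size (take hi s) = hi by rewrite size_takel ?sz.
rewrite szt take_takel ?leq_subr //.
have hiK : hi - a + a = hi by rewrite subnK; lia.
have incolI i : hi - a <= i < hi -> incol i.
  move=> /andP[li ih]; case: (eqVneq i hi.-1) => [->//|ne].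
  by have /linkI/andP[] : link i by apply: aI; lia.
have CP := @cut_okP a (hi - a) s sz; rewrite hiK in CP; have {}CP := CP le_n.
split=> [/andP[/CP[k1 k2] /(H0 _ _ _ _ sz)[[c1 c2] r]]|[[c1 c2] r]].
  split=> //; split=> [i /andP[li ih]|i li ih l1 l2].
    case: (leqP (hi - a) i) => [ge|lt]; first by rewrite incolI ?ge ?k1 ?ge.
    by apply: c1; rewrite li lt.
  case: (leqP (hi - a) i) => [ge|lt]; first exact: k2.
  case: (ltnP i.+2 (hi - a)) => [lt2|ge2]; first exact: c2.
  case: aL => [|nl]; first by lia.
  have [E|E] : (hi - a).-1 = i \/ (hi - a).-1 = i.+1 by lia.
    by rewrite E l1 in nl.
  by rewrite E l2 in nl.
apply/andP; split.
  apply/CP; split=> [i iI|i li ih]; first by rewrite c1 ?incolI //; lia.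
  by apply: c2; try apply: aI; lia.
apply/(H0 _ _ _ _ sz); split=> //; split=> [i|i] li *; first by apply: c1; lia.
by apply: c2 => //; lia.
Qed.

Definition in_word (inrow : pred nat) (x : nat -> nat) r :=
  [seq x i | i <- iota 0 r & inrow i].

Lemma in_wordS inrow x r : in_word inrow x r.+1 =
  if inrow r then rcons (in_word inrow x r) (x r) else in_word inrow x r.
Proof.
rewrite /in_word -addn1 iotaD filter_cat map_cat /= add0n.
by case: ifP => _; rewrite ?cats0 ?cats1.
Qed.

Definition row_cond good (inrow : pred nat) (c skip x : nat -> nat) r :=
  if inrow r then
    [&& x r < c r, nth (Some 0) (tab n (in_word inrow x r)) (x r) == None
      & good (shape n (take (c r) (tab n (in_word inrow x r.+1))))]
  else x r == skip r.

(** [c r] is the number of columns present while row [r] is read; the columns from [c r] on are cut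
    just before. With [c n = 0] nothing is left at the end. *)
Lemma ops_exist (inrow incol link : pred nat) (c skip : nat -> nat) :
  c 0 <= n -> (forall r, c r.+1 <= c r) -> c n = 0 ->
  (forall i, link i -> incol i && incol i.+1) ->
  exists ops, [/\ all wf_op ops, sumn (map width ops) = n, count is_letter ops = n &
    forall good x, run good ops [seq x r | r <- iota 0 n] (nseq n None) <->
      (forall r, r < n -> row_cond good inrow c skip x r) /\
      (forall r, r <= n -> cut_cond incol link (c r) (if r is r'.+1 then c r' else n)
         (tab n (in_word inrow x r)))].
Proof.
move=> c0 cS cn linkI; pose cp r := if r is r'.+1 then c r' else n.
have cpn r : cp r <= n.
  by case: r => //= r; elim: r => //= r IH; apply: leq_trans (cS r) IH.
have ccp r : c r <= cp r by case: r => /=.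
have main d : forall r, r + d = n -> exists ops, [/\ all wf_op ops, sumn (map width ops) = cp r, count is_letter ops = d &
    forall good x, run good ops [seq x r' | r' <- iota r d] (take (cp r) (tab n (in_word inrow x r))) <->
      (forall r', r <= r' -> r' < n -> row_cond good inrow c skip x r') /\
      (forall r', r <= r' -> r' <= n -> cut_cond incol link (c r') (cp r')
         (tab n (in_word inrow x r')))].
  elim: d => [|d IH] r Er.
    have [ops0 [w0 s0 l0 H0]] := cuts_exist (ccp r) (cpn r) linkI.
    have En : r = n by rewrite -Er addn0.
    exists ops0; split=> //; first by rewrite s0 En cn subn0.
    move=> good x; rewrite -[ops0]cats0; split=> [/(H0 _ _ _ _ (size_tab _ _))[H _]|[_ H]].
      split=> [r'|r' l1 l2]; first by lia.
      by have -> : r' = r by lia.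
    by apply/(H0 _ _ _ _ (size_tab _ _)); split=> //; apply: H => //; rewrite En.
  have [ops1 [w1 s1 l1 H1]] := IH r.+1 (etrans (addSnnS _ _) Er).
  have [ops0 [w0 s0 l0 H0]] := cuts_exist (ccp r) (cpn r) linkI.
  exists (ops0 ++ (if inrow r then Insert else Skip (skip r)) :: ops1); split.
  - by rewrite all_cat w0 /= w1 andbT; case: ifP.
  - rewrite map_cat sumn_cat s0 /= s1 /=; have := ccp r.
    by case: ifP => _ /=; lia.
  - by rewrite count_cat l0 /= l1; case: ifP.
  move=> good x; set W := in_word inrow x r.
  have step : run good ((if inrow r then Insert else Skip (skip r)) :: ops1)
     [seq x r' | r' <- iota r d.+1] (take (c r) (tab n W)) <->
     row_cond good inrow c skip x r /\
     run good ops1 [seq x r' | r' <- iota r.+1 d] (take (cp r.+1) (tab n (in_word inrow x r.+1))).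
    rewrite /row_cond [in_word inrow x r.+1]in_wordS -/W; case: ifP => ir /=; last first.
      by split=> [/andP[]//|[-> ->]].
    have szc : size (take (c r) (tab n W)) = c r.
      by rewrite size_takel // size_tab (leq_trans (ccp r)).
    rewrite szc tab_rcons; case: ltnP => [lt_x|] /=; last by split=> // -[].
    rewrite take_ins_lt // nth_take //.
    by split=> [/and3P[-> -> ->]|[/andP[-> ->] ->]].
  split=> [/(H0 _ _ _ _ (size_tab _ _))[Hc /step[Hr /H1[HR HC]]]|[HR HC]].
    split=> r' le_r; case: (eqVneq r' r) => [-> //|ne] lt_n.
      by apply: HR => //; lia.
    by apply: HC => //; lia.
  apply/(H0 _ _ _ _ (size_tab _ _)); split; first by apply: HC => //; lia.
  apply/step; split; first by apply: HR => //; lia.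
  by apply/H1; split=> r' le_r; [apply: HR | apply: HC]; lia.
have [ops [wo so lo Ho]] := main n 0 (add0n n).
exists ops; split=> // good x; have := Ho good x.
rewrite take_oversize ?size_tab // => E; split=> [/E[H1 H2]|[H1 H2]].
  by split=> r; [apply: H1 | apply: H2].
by apply/E; split=> r _; [apply: H1 | apply: H2].
Qed.

End Run.

(** * Cells north-east of which tau occurs *)

Section NorthEast.
Variables (n m : nat) (tau : 'S_m).
Implicit Types (p : 'S_n.+1) (a b : 'I_n.+1).

Definition is_copy p (g : {ffun 'I_m -> 'I_n.+1}) :=
  [forall u : 'I_m, forall v : 'I_m, ((u < v) ==> (g u < g v)) && ((tau u < tau v) == (p (g u) < p (g v)))].

Definition copyNE p (i j : nat) :=
  [exists g, is_copy p g && [forall u, (i < g u) && (j < p (g u))]].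

Lemma is_copyP p (g : {ffun 'I_m -> 'I_n.+1}) : reflect ((forall u v : 'I_m, u < v -> g u < g v) /\
  (forall u v, (tau u < tau v) = (p (g u) < p (g v)))) (is_copy p g).
Proof.
apply: (iffP forallP) => [H|[H1 H2] u].
  split=> u v; have /forallP/(_ v)/andP[/implyP H1 /eqP H2] := H u; [exact: H1 | exact: H2].
by apply/forallP => v; rewrite H2 eqxx andbT; apply/implyP/H1.
Qed.

Lemma copyNEP p i j : reflect (exists2 g, is_copy p g & forall u, i < g u /\ j < p (g u))
  (copyNE p i j).
Proof.
apply: (iffP existsP) => [[g /andP[cg /forallP H]]|[g cg H]]; exists g => //.
  by move=> u; apply/andP.
by rewrite cg; apply/forallP => u; apply/andP.
Qed.

Lemma copyNE_mono p i j i' j' : i' <= i -> j' <= j -> copyNE p i j -> copyNE p i' j'.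
Proof.
move=> le_i le_j /copyNEP[g cg H]; apply/copyNEP; exists g => // u; have [H1 H2] := H u.
by split; [apply: leq_ltn_trans H1 | apply: leq_ltn_trans H2].
Qed.

Definition inside p a := copyNE p a (p a).

(** If a copy uses an inside point, pass to a copy north-east of that point. This moves east, so it
    stops at a copy made of outside points. *)
Lemma copyNE_outside p i j : copyNE p i j ->
  exists2 g, is_copy p g & forall u, [/\ i < g u, j < p (g u) & ~~ inside p (g u)].
Proof.
have [d] := ubnP (n.+1 - i); elim: d i j => // d IH i j lt_d /copyNEP[g cg H].
have [/forallP out|] := boolP [forall u, ~~ inside p (g u)].
  by exists g => // u; have [H1 H2] := H u.
rewrite negb_forall => /existsP[u]; rewrite negbK => ins_u; have [H1 H2] := H u.
have [|g' cg' H'] := IH _ _ _ ins_u; first by have := ltn_ord (g u); lia.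
exists g' => // v; have [K1 K2 K3] := H' v.
by split=> //; [apply: ltn_trans K1 | apply: ltn_trans K2].
Qed.

Definition same_class p0 p :=
  [forall a, if inside p0 a then copyNE p0 a (p a) else p a == p0 a].

Lemma same_classP p0 p : reflect ((forall a, inside p0 a -> copyNE p0 a (p a)) /\
  (forall a, ~~ inside p0 a -> p a = p0 a)) (same_class p0 p).
Proof.
apply: (iffP forallP) => [H|[H1 H2] a].
  split=> a ia; have := H a; first by rewrite ia.
  by rewrite (negPf ia) => /eqP.
by case: ifPn => [/H1|/H2 ->].
Qed.

(** Copies can be taken among outside points, which [p0] and [p] share. The first inclusion shows
    that a point outside for [p] is outside for [p0], as the second one requires. *)
Lemma same_class_copy p0 p : same_class p0 p -> forall i j, copyNE p i j = copyNE p0 i j.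
Proof.
move=> /same_classP[H1 H2].
have le i j : copyNE p0 i j -> copyNE p i j.
  case/copyNE_outside => g /is_copyP[c1 c2] H; apply/copyNEP; exists g.
    apply/is_copyP; split=> // u v; have [_ _ o1] := H u; have [_ _ o2] := H v.
    by rewrite !H2.
  by move=> u; have [K1 K2 o1] := H u; rewrite H2.
have out a : ~~ inside p a -> ~~ inside p0 a.
  by apply: contra => /H1 /le.
move=> i j; apply/idP/idP; last exact: le.
case/copyNE_outside => g /is_copyP[c1 c2] H; apply/copyNEP; exists g.
  apply/is_copyP; split=> // u v; have [_ _ /out o1] := H u; have [_ _ /out o2] := H v.
  by rewrite -!H2.
by move=> u; have [K1 K2 /out o1] := H u; rewrite -H2.
Qed.

Lemma same_class_inside p0 p a : same_class p0 p -> inside p a = inside p0 a.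
Proof.
move=> sc; rewrite /inside (same_class_copy sc); move/same_classP: sc => [H1 H2].
apply/idP/idP => [|/H1 //].
by apply: contraTT => ia; rewrite (H2 a ia).
Qed.

(** An invariant with finitely many values whose fibres are the classes, so that counts can be split
    over it. *)
Definition class_key p : {set 'I_n.+1 * 'I_n.+1} * {ffun 'I_n.+1 -> option 'I_n.+1} :=
  ([set b : 'I_n.+1 * 'I_n.+1 | copyNE p b.1 b.2],
   [ffun a => if inside p a then None else Some (p a)]).

Lemma class_keyP p0 p : (class_key p == class_key p0) = same_class p0 p.
Proof.
apply/eqP/idP => [[E1 /ffunP E2]|sc].
  apply/same_classP; split=> a ia.
    have := E2 a; rewrite !ffunE ia; case: ifP => // ipa _.
    by move/setP/(_ (a, p a)): E1; rewrite !inE => <-.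
  by have := E2 a; rewrite !ffunE (negPf ia); case: ifP => // _ [].
congr (_, _); first by apply/setP => b; rewrite !inE (same_class_copy sc).
apply/ffunP => a; rewrite !ffunE (same_class_inside a sc); case: ifPn => // ia.
by move/same_classP: sc => [_ ->].
Qed.

(** Where the diagram gets lower, every copy north-east of the lost cell has to use the point of the
    next column. This gives the ascent from an inside to an outside column and the equal heights of
    adjacent inside columns. *)
Lemma copyNE_drop p i j b : b = i.+1 :> nat -> copyNE p i j -> ~~ copyNE p i.+1 j ->
  j < p b /\ ~~ inside p b.
Proof.
move=> Eb /copyNEP[g cg H] nc.
have [/forallP out|] := boolP [forall u, i.+1 < g u].
  by case/negP: nc; apply/copyNEP; exists g => // u; have [_ ?] := H u; rewrite out.
rewrite negb_forall => /existsP[u]; have [H1 H2] := H u; rewrite -leqNgt => le_g.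
have Eg : b = g u by apply: ord_inj; rewrite Eb; apply/eqP; rewrite eqn_leq H1 le_g.
rewrite Eg; split=> //; apply: contra nc; rewrite /inside -Eg Eb.
by apply: copyNE_mono => //; rewrite Eg ltnW.
Qed.

Lemma inside_outside p a b : b = a.+1 :> nat -> inside p a -> ~~ inside p b -> p a < p b.
Proof.
move=> Eb ia ob; have [c|nc] := boolP (copyNE p a.+1 (p a)); last first.
  by have [] := copyNE_drop Eb ia nc.
rewrite ltnNge; apply: contra ob => le_p; rewrite /inside Eb.
exact: copyNE_mono c.
Qed.

Lemma outside_inside p a b : b = a.+1 :> nat -> ~~ inside p a -> inside p b -> p b < p a.
Proof.
move=> Eb oa ib; rewrite ltnNge; apply: contra oa => le_p.
by apply: copyNE_mono ib; rewrite // Eb.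
Qed.

Lemma inside_inside p a b j : b = a.+1 :> nat -> inside p b ->
  copyNE p a j = copyNE p b j.
Proof.
move=> Eb ib; apply/idP/idP => [ca|]; last by apply: copyNE_mono; rewrite // Eb.
rewrite Eb; apply: contraT => nc; have [_] := copyNE_drop Eb ca nc.
by rewrite ib.
Qed.

Lemma contains_dsumP k (sigma : 'S_k) p : 0 < k ->
  contains p (dsum sigma tau) <->
  exists f : 'I_k -> 'I_n.+1, exists i, exists j,
    [/\ forall u v : 'I_k, u < v -> f u < f v,
        forall u v, (sigma u < sigma v) = (p (f u) < p (f v)),
        forall u, f u <= i /\ p (f u) <= j & copyNE p i j].
Proof.
move=> k0; split.
  case/existsP => F /andP[/forallP F1 /forallP F2].
  have {}F1 (u v : 'I_(k + m)) : u < v -> F u < F v by have /forallP/(_ v)/implyP := F1 u.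
  have {}F2 u v : (dsum sigma tau u < dsum sigma tau v) = (p (F u) < p (F v)).
    by have /forallP/(_ v)/eqP := F2 u.
  have dl (u : 'I_k) : dsum sigma tau (lshift m u) = lshift m (sigma u).
    rewrite permE /dsum_fun; case: split_ordP => [w /lshift_inj -> //|w /eqP].
    by rewrite eq_lrshift.
  have dr (u : 'I_m) : dsum sigma tau (rshift k u) = rshift k (tau u).
    rewrite permE /dsum_fun; case: split_ordP => [w /eqP|w /rshift_inj -> //].
    by rewrite eq_rlshift.
  (* The bounding corner is given by the largest position and the largest value of the chain. *)
  exists (fun u => F (lshift m u)), (\max_(u < k) F (lshift m u)), (\max_(u < k) p (F (lshift m u))).
  split=> [u v lt_uv|u v|u|].
  - exact: F1.
  - by rewrite -F2 !dl.
  - by split; [apply: (leq_bigmax u) | apply: (leq_bigmax (F := fun u => val (p (F (lshift m u)))) u)].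
  apply/copyNEP; exists [ffun u => F (rshift k u)].
    apply/is_copyP; split=> u v; rewrite !ffunE; first by move=> lt_uv; apply: F1; rewrite /= ltn_add2l.
    by rewrite -F2 !dr /= ltn_add2l.
  have k0' : 0 < #|'I_k| by rewrite card_ord.
  move=> u; rewrite ffunE; split.
    have [u1 ->] := eq_bigmax (fun u : 'I_k => val (F (lshift m u))) k0'.
    by apply: F1; rewrite /= (leq_trans (ltn_ord _) (leq_addr _ _)).
  have [u1 ->] := eq_bigmax (fun u : 'I_k => val (p (F (lshift m u)))) k0'.
  by rewrite -F2 dl dr /= (leq_trans (ltn_ord _) (leq_addr _ _)).
case=> f [i [j [f1 f2 f3 /copyNEP[g /is_copyP[g1 g2] g3]]]].
apply/existsP; exists [ffun w => match split w with inl u => f u | inr u => g u end].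
apply/andP; split; apply/forallP => u; apply/forallP => v.
  apply/implyP; rewrite !ffunE; case: (split_ordP u) => u' ->; case: (split_ordP v) => v' -> /=.
  - exact: f1.
  - by move=> _; have [le_i _] := f3 u'; have [lt_i _] := g3 v'; apply: leq_ltn_trans lt_i.
  - by rewrite ltnNge (leq_trans (ltnW (ltn_ord v')) (leq_addr _ _)).
  - by rewrite ltn_add2l => /g1.
rewrite !permE !ffunE /dsum_fun; case: (split_ordP u) => u' _; case: (split_ordP v) => v' _ /=.
- by rewrite f2.
- have [_ le_j] := f3 u'; have [_ lt_j] := g3 v'.
  by rewrite (leq_ltn_trans le_j lt_j) (leq_trans (ltn_ord _) (leq_addr _ _)).
- have [_ le_j] := f3 v'; have [_ lt_j] := g3 u'.
  rewrite (leq_gtF (ltnW (leq_ltn_trans le_j lt_j))).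
  by rewrite (leq_gtF (leq_trans (ltnW (ltn_ord _)) (leq_addr _ _))).
by rewrite ltn_add2l g2.
Qed.

End NorthEast.

(** * Chains inside the diagram *)

Section Good.
Variables (n k : nat).

(* [b = true] stands for the decreasing pattern. *)
Definition good (b : bool) (nu : {set 'I_n * 'I_n}) :=
  [forall c, (c \in nu) ==> ((if b then c.1 else c.2).+1 < k)].

Lemma good_transpose nu : good true (transpose nu) = good false nu.
Proof.
apply/forallP/forallP => H c; apply/implyP => cn.
  by have /implyP := H (swap c); rewrite !inE swapK; apply.
by have /implyP := H (swap c); apply; move: cn; rewrite inE.
Qed.

Lemma good_shape b s : 0 < k -> lattice s -> size s <= n ->
  good b (shape n s) = ((if b then lis 0 s else cnt 0 s) < k).
Proof.
move=> k0 ls sz; apply/forallP/idP => [H|H [i j]]; last first.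
  rewrite mem_shape; apply/implyP => /= lt_j; case: b H => H.
    by apply: leq_ltn_trans H; apply: lis_lattice_ge ls _; apply: leq_ltn_trans lt_j.
  by apply: leq_ltn_trans H; apply: leq_trans lt_j (lattice_cnt ls _).
case: b H => H.
  rewrite -(prednK k0) ltnS; apply/(lis_lattice _ ls) => i le_ki.
  apply/eqP; rewrite -leqn0 leqNgt; apply/negP => c0.
  have lt_i : i < n by apply: leq_trans sz; apply: lattice_cnt_size ls c0.
  have lt_0 : 0 < n by apply: leq_ltn_trans lt_i.
  have /implyP := H (Ordinal lt_i, Ordinal lt_0); rewrite mem_shape => /(_ c0) /=.
  by lia.
case: (posnP (cnt 0 s)) => [->//|c0]; have lt_c : (cnt 0 s).-1 < n.
  by rewrite prednK //; apply: leq_trans (cnt_size 0 s) sz.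
have lt_0 : 0 < n by apply: leq_ltn_trans lt_c.
have /implyP := H (Ordinal lt_0, Ordinal lt_c); rewrite mem_shape /= prednK //; exact.
Qed.
End Good.

(** * The diagram of a class, read row by row *)

Section Class.
Variables (n m : nat) (tau : 'S_m) (p0 : 'S_n.+1) (E : {set 'I_n.+1}).
Implicit Types (p : 'S_n.+1).
Notation N := n.+1.

Definition column p (r : nat) : nat := (p^-1)%g (inord r).
Definition inrow r := inside tau p0 ((p0^-1)%g (inord r)).
Definition incol i := (i < N) && inside tau p0 (inord i).
Definition link i := [&& incol i, incol i.+1 & inord i \notin E].
(** The first column outside the diagram; by [copyNE_mono] rows are initial segments. Length 0
    beyond the grid makes all remaining columns go at the end. *)
Definition rowlength r :=
  if r < N then find (fun x => ~~ copyNE tau p0 x r) (iota 0 N) else 0.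

Lemma ltn_rowlength r x : r < N -> (x < rowlength r) = (x < N) && copyNE tau p0 x r.
Proof.
move=> lt_r; rewrite /rowlength lt_r; set P := fun x => _.
have [le_x|lt_x] := leqP N x.
  by apply/negbTE; rewrite -leqNgt (leq_trans (find_size _ _)) ?size_iota.
apply/idP/idP => [/(before_find 0)|].
  by rewrite nth_iota // add0n /P => /negbT; rewrite negbK.
apply: contraTT; rewrite -leqNgt => le_x.
have hP : has P (iota 0 N) by rewrite has_find size_iota (leq_ltn_trans le_x).
have := nth_find 0 hP; rewrite nth_iota ?add0n; last by rewrite (leq_ltn_trans le_x).
by rewrite /P; apply: contra; apply: copyNE_mono.
Qed.

Lemma rowlengthS r : rowlength r.+1 <= rowlength r.
Proof.
rewrite {1}/rowlength; case: ifP => // lt_r.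
have -> : find (fun x => ~~ copyNE tau p0 x r.+1) (iota 0 N) = rowlength r.+1.
  by rewrite /rowlength lt_r.
rewrite leqNgt; apply/negP; rewrite ltn_rowlength // => /andP[lt_x c].
have : rowlength r < rowlength r by rewrite ltn_rowlength ?(ltnW lt_r) // lt_x (copyNE_mono _ _ c).
by rewrite ltnn.
Qed.

Lemma rowlength_anti r r' : r <= r' -> rowlength r' <= rowlength r.
Proof.
move=> /subnKC <-; elim: (r' - r) => [|d IH]; first by rewrite addn0.
by rewrite addnS; apply: leq_trans (rowlengthS _) IH.
Qed.

Lemma rowlength0 : rowlength N = 0.
Proof. by rewrite /rowlength ltnn. Qed.

Lemma rowlength_leq r : rowlength r <= N.
Proof. by rewrite /rowlength; case: ifP => // _; rewrite -[X in _ <= X](size_iota 0) find_size. Qed.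

Lemma columnK p r : r < N -> p (inord (column p r)) = r :> nat.
Proof. by move=> lt_r; rewrite /column inord_val permKV inordK. Qed.

Lemma column_perm p (a : 'I_N) : column p (p a) = a.
Proof. by rewrite /column inord_val permK. Qed.

Lemma column_lt p r : column p r < N. Proof. exact: ltn_ord. Qed.

Lemma column_inj p r r' : r < N -> r' < N -> column p r = column p r' -> r = r'.
Proof. by move=> lr lr' e; rewrite -(columnK p lr) e columnK. Qed.

Lemma inrow_same p (a : 'I_N) : same_class tau p0 p -> inrow (p a) = inside tau p0 a.
Proof.
case/same_classP => H1 H2; rewrite /inrow inord_val.
have [ia|oa] := boolP (inside tau p0 a); last by rewrite H2 // permK (negPf oa).
apply: contraT => o; have := H2 _ o; rewrite permKV => /perm_inj e.
by rewrite e ia in o.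
Qed.

Definition rowword p r := in_word inrow (column p) r.

Lemma mem_rowword p r i : i < N -> r <= N ->
  (i \in rowword p r) = (p (inord i) < r) && inrow (p (inord i)).
Proof.
move=> lt_i le_r; apply/mapP/andP => [[r']|[lt_p ir]].
  rewrite mem_filter mem_iota add0n => /andP[ir /andP[_ lt_r]] ->.
  by rewrite columnK // (leq_trans lt_r).
exists (val (p (inord i))); first by rewrite mem_filter ir mem_iota.
by rewrite column_perm inordK.
Qed.

Lemma all_rowword p r : all (fun x => x < N) (rowword p r).
Proof. by apply/allP => _ /mapP[r' _ ->]; apply: column_lt. Qed.

Lemma uniq_rowword p r : r <= N -> uniq (rowword p r).
Proof.
move=> le_r; rewrite map_inj_in_uniq ?filter_uniq ?iota_uniq // => a b.
rewrite !mem_filter !mem_iota !add0n => /andP[_ /andP[_ la]] /andP[_ /andP[_ lb]].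
by apply: column_inj; [apply: leq_trans la le_r | apply: leq_trans lb le_r].
Qed.

Lemma index_rowword p r (a b : 'I_N) : r <= N ->
  (a : nat) \in rowword p r -> (b : nat) \in rowword p r ->
  (index (a : nat) (rowword p r) < index (b : nat) (rowword p r)) = (p a < p b).
Proof.
move=> le_r; rewrite !mem_rowword // !inord_val => /andP[la ia] /andP[lb ib].
pose L := [seq i <- iota 0 r | inrow i].
have sL : sorted ltn L by apply: sorted_filter; [exact: ltn_trans | exact: iota_ltn_sorted].
have idx (d : 'I_N) : p d < r -> inrow (p d) -> index (d : nat) (rowword p r) = index (p d : nat) L.
  move=> ld id; rewrite -{1}(column_perm p d) /rowword /in_word -/L.
  have pL : (p d : nat) \in L by rewrite mem_filter id mem_iota.
  have uL : uniq L by rewrite filter_uniq ?iota_uniq.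
  have um : uniq [seq column p i | i <- L] := uniq_rowword p le_r.
  rewrite -{1}(nth_index 0 pL) -(nth_map 0 0) ?index_mem // index_uniq ?size_map ?index_mem //.
have aL : (p a : nat) \in L by rewrite mem_filter ia mem_iota.
have bL : (p b : nat) \in L by rewrite mem_filter ib mem_iota.
rewrite !idx //; apply/idP/idP; first exact: (sorted_ltn_index ltn_trans sL).
move=> lt_p; rewrite ltnNge leq_eqVlt; apply/negP => /orP[/eqP e|].
  by move: lt_p; rewrite -(nth_index 0 aL) -(nth_index 0 bL) e ltnn.
by move/(sorted_ltn_index ltn_trans sL _ _ bL aL); rewrite ltnNge (ltnW lt_p).
Qed.

Lemma has_chain_rows (rel : rel nat) k p r (P : pred nat) :
  has_chain rel k (rowword p r) P <->
  exists rs, [/\ sorted ltn rs, size rs = k, all (fun r' => (r' < r) && inrow r') rs,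
    sorted rel (map (column p) rs) & all P (map (column p) rs)].
Proof.
pose L := [seq i <- iota 0 r | inrow i].
have sL : sorted ltn L by apply: sorted_filter; [exact: ltn_trans | exact: iota_ltn_sorted].
split=> [[s [/subseqP[msk sm ->] so sz al]]|[rs [so sz al sr alP]]].
  exists (mask msk L); rewrite -map_mask in so sz al *; split=> //.
  - by apply: sorted_mask => //; apply: ltn_trans.
  - by rewrite -sz size_map.
  by apply/allP => r' /mem_mask; rewrite mem_filter mem_iota add0n andbC.
exists (map (column p) rs); split=> //; last by rewrite size_map.
apply: map_subseq; rewrite (_ : rs = [seq i <- L | i \in rs]) ?filter_subseq //.
apply: (irr_sorted_eq ltn_trans ltnn) => //.
  by apply: sorted_filter => //; apply: ltn_trans.
move=> x; rewrite !mem_filter mem_iota add0n /=.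
case: (boolP (x \in rs)) => //= xr; have := allP al _ xr.
by rewrite andbC => ->.
Qed.

Section Chains.
Variable k : nat.

Definition pattern (b : bool) : 'S_k.+1 := if b then decr_perm k.+1 else incr_perm k.+1.
Definition chain_rel (b : bool) : rel nat := if b then gtn else ltn.
(** Numbers a chain from bottom to top for either pattern, so that only the comparison of positions
    depends on [b]. *)
Definition orient (b : bool) : 'I_k.+1 -> 'I_k.+1 := if b then @rev_ord k.+1 else id.

Lemma pattern_orient b u v : (pattern b u < pattern b v) = (orient b u < orient b v).
Proof. by case: b; rewrite /pattern /orient ?permE ?perm1. Qed.

Lemma orientK b : involutive (orient b).
Proof. by case: b; rewrite /orient //; apply: rev_ordK. Qed.

Lemma orient_lt b u v : (orient b u < orient b v) = chain_rel b u v.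
Proof. by case: b; rewrite /orient /chain_rel //=; have := ltn_ord u; have := ltn_ord v; lia. Qed.

Lemma chain_rel_trans b : transitive (chain_rel b).
Proof. by case: b; [apply: gtn_trans | apply: ltn_trans]. Qed.

Lemma sorted_mkseq_ord (r : rel nat) (h : 'I_k.+1 -> nat) : transitive r ->
  (forall u v : 'I_k.+1, u < v -> r (h u) (h v)) <->
  sorted r (mkseq (fun i => h (inord i)) k.+1).
Proof.
move=> tr; split=> [H|/(sortedP 0) so u v lt_uv].
  apply/(sortedP 0) => i; rewrite size_mkseq => lt_i; rewrite !nth_mkseq //; last exact: ltnW.
  by apply: H; rewrite !inordK //; apply: ltnW.
have := @sorted_ltn_nth _ r tr 0 (mkseq (fun i => h (inord i)) k.+1) _ u v.
rewrite !inE size_mkseq !nth_mkseq // !inord_val; apply=> //.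
exact/(sortedP 0).
Qed.

(** The corner of a chain lies in the row [r] of its topmost point, so the chain must fit into the
    columns of row [r]. Conversely the last cell of row [r] serves as corner. *)
Lemma contains_chain b p : same_class tau p0 p ->
  contains p (dsum (pattern b) tau) <->
  exists r, [/\ r < N, inrow r & has_chain (chain_rel b) k.+1 (rowword p r.+1) (fun x => x < rowlength r)].
Proof.
move=> sc; rewrite contains_dsumP //; split.
  case=> f [i [j [f1 f2 f3 cij]]].
  pose h u := val (p (f (orient b u))).
  have h_lt (u v : 'I_k.+1) : u < v -> h u < h v.
    by move=> lt_uv; rewrite /h -f2 pattern_orient !orientK.
  have h_in u : inside tau p0 (f (orient b u)).
    have [le_i le_j] := f3 (orient b u); rewrite -(same_class_inside _ sc).
    exact: copyNE_mono cij.
  have Emap : map (column p) (mkseq (fun i => h (inord i)) k.+1) =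
      mkseq (fun i => val (f (orient b (inord i)))) k.+1.
    by rewrite -map_comp; apply: eq_map => u /=; rewrite /h column_perm.
  exists (h ord_max); split; [exact: ltn_ord | by rewrite inrow_same|].
  apply/has_chain_rows; exists (mkseq (fun i => h (inord i)) k.+1); split.
  - exact/(sorted_mkseq_ord _ ltn_trans).
  - by rewrite size_mkseq.
  - apply/allP => _ /mapP[u _ ->]; rewrite /h inrow_same // h_in andbT ltnS.
    have [->//|ne] := eqVneq (inord u) (@ord_max k).
    by apply/ltnW/h_lt; rewrite ltn_neqAle -ltnS ltn_ord andbT; apply: contraNneq ne => e; apply/eqP/val_inj.
  - rewrite Emap; apply/(sorted_mkseq_ord (fun u => val (f (orient b u))) (@chain_rel_trans b)).
    move=> u v lt_uv; have : chain_rel b (f (orient b u)) (f (orient b v)).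
      have := orient_lt b (orient b u) (orient b v); rewrite !orientK lt_uv.
      by case: b {h h_lt h_in Emap f2} => /= /esym ou; apply: f1.
    by [].
  rewrite Emap; apply/allP => _ /mapP[u _ ->]; rewrite ltn_rowlength ?ltn_ord //=.
  have [le_i _] := f3 (orient b (inord u)); have [_ le_j] := f3 (orient b ord_max).
  by rewrite -(same_class_copy sc); apply: copyNE_mono cij.
case=> r [lt_r ir /has_chain_rows[rs [so sz al sr alP]]].
have lt_rs (u : 'I_k.+1) : nth 0 rs u <= r /\ nth 0 rs u < N.
  have /allP/(_ (nth 0 rs u)) := al; rewrite mem_nth ?sz // => /(_ isT)/andP[le_r _].
  by split=> //; apply: leq_trans le_r _.
pose g (u : 'I_k.+1) : 'I_N := (p^-1)%g (inord (nth 0 rs u)).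
have gE u : val (g u) = nth 0 (map (column p) rs) u by rewrite (nth_map 0) ?sz.
have pg u : p (g u) = nth 0 rs u :> nat.
  by rewrite /g permKV inordK //; case: (lt_rs u).
have g_c u : g u < rowlength r.
  by have /allP/(_ (val (g u))) := alP; apply; rewrite gE mem_nth ?size_map ?sz.
exists (fun u => g (orient b u)), (rowlength r).-1, r; split=> [u v lt_uv|u v|u|].
- have := @sorted_ltn_nth _ _ (@chain_rel_trans b) 0 _ sr.
  case: b sr => /= sr H.
    by have := H (orient true v) (orient true u); rewrite !inE size_map sz !ltn_ord -!gE; apply=> //; rewrite orient_lt.
  by have := H u v; rewrite !inE size_map sz !ltn_ord -!gE; apply.
- rewrite pattern_orient !pg; set u' := orient b u; set v' := orient b v.
  have nth_lt (x y : 'I_k.+1) : x < y -> nth 0 rs x < nth 0 rs y.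
    by move=> lt_xy; apply: (sorted_ltn_nth ltn_trans 0 so); rewrite ?inE ?sz.
  case: (ltngtP u' v') => [/nth_lt->//|/nth_lt lt_n|/ord_inj->]; last by rewrite ltnn.
  by rewrite ltnNge ltnW.
- split; last by rewrite pg; case: (lt_rs (orient b u)).
  by have := g_c (orient b u); lia.
rewrite (same_class_copy sc); have c0 : 0 < rowlength r by apply: leq_ltn_trans (g_c ord0).
by have := ltn_rowlength (rowlength r).-1 lt_r; rewrite prednK // leqnn => /esym/andP[].
Qed.

End Chains.
End Class.

(** * Counting a class of permutations *)

Section Class.
Variables (n m k : nat) (tau : 'S_m) (p0 : 'S_n.+1) (E : {set 'I_n.+1}).
Implicit Types (p : 'S_n.+1) (b : bool).
Notation N := n.+1.
Notation column := (@column n).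
Notation inrow := (inrow tau p0).
Notation incol := (incol tau p0).
Notation link := (link tau p0 E).
Notation rowlength := (rowlength tau p0).
Notation rowword := (rowword tau p0).

Lemma link_incol i : link i -> incol i && incol i.+1.
Proof. by case/and3P => -> ->. Qed.

(** Linked columns have equal height, so a run is complete, and is cut, at a single stage. *)
Lemma link_rowlength i r : link i -> (i < rowlength r) = (i.+1 < rowlength r).
Proof.
case/and3P => /andP[lt_i ia] /andP[lt_i1 ib] _.
have [lt_r|le_r] := ltnP r N; last by rewrite /rowlength [r < _]ltnNge le_r.
rewrite !ltn_rowlength // lt_i lt_i1 /=.
have := @inside_inside _ _ tau p0 (inord i) (inord i.+1) r; rewrite !inordK //; exact.
Qed.

Definition prevlength r := if r is r'.+1 then rowlength r' else N.

Lemma stage_exist i : i < N -> exists r, [/\ r <= N, rowlength r <= i & i < prevlength r].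
Proof.
move=> lt_i; have ex : exists r, rowlength r <= i by exists N; rewrite rowlength0.
have [r le_r rmin] := ex_minnP ex; exists r; split=> //.
  by apply: rmin; rewrite rowlength0.
case: r le_r rmin => //= r le_r rmin; rewrite ltnNge; apply/negP => /rmin.
by rewrite ltnn.
Qed.

Definition accepts (ops : seq op) := forall (gd : pred {set 'I_N * 'I_N}) x,
  run gd ops [seq x r | r <- iota 0 N] (nseq N None) <->
  (forall r, r < N -> row_cond gd inrow rowlength (column p0) x r) /\
  (forall r, r <= N -> cut_cond incol link (rowlength r) (prevlength r)
    (tab N (in_word inrow x r))).

Definition column_word p := [seq column p r | r <- iota 0 N].

Definition linked_valleys p := forall i, link i -> link i.+1 ->
  p (inord i) < p (inord i.+1) -> p (inord i.+1) < p (inord i.+2).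

Lemma same_class_rows p : same_class tau p0 p <->
  (forall r, r < N -> if inrow r then column p r < rowlength r else column p r == column p0 r).
Proof.
split=> [sc r lt_r|H].
  have [a Ea] : exists a, r = p a.
    by exists ((p^-1)%g (inord r)); rewrite permKV inordK.
  subst r; rewrite inrow_same // column_perm.
  move/same_classP: sc => [H1 H2]; case: ifPn => [/H1|/H2 ->].
    by rewrite ltn_rowlength // ltn_ord.
  by rewrite column_perm.
apply/same_classP; split=> a ia.
  have := H (p a) (ltn_ord _); rewrite column_perm; case: ifPn.
    by rewrite ltn_rowlength ?ltn_ord // => _ /andP[].
  move=> ip /eqP e; move: ip; rewrite /inrow.
  suff -> : ((p0^-1)%g (inord (p a))) = a by rewrite ia.
  by apply: ord_inj; rewrite [RHS]e.
have := H (p0 a) (ltn_ord _); rewrite /inrow inord_val permK (negPf ia) column_perm => /eqP.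
move=> e; apply: (@perm_inj _ p^-1%g); rewrite permK; apply: ord_inj; rewrite -e.
by rewrite /column inord_val.
Qed.

(** Once a column is complete all its cells in the diagram have been read, so it is used precisely
    when its point is inside. *)
Lemma class_incol p r i : same_class tau p0 p -> r <= N -> rowlength r <= i -> i < N ->
  (i \in rowword p r) = incol i.
Proof.
move=> sc le_r le_i lt_i; rewrite mem_rowword // inrow_same // /incol lt_i /=.
case: (boolP (inside _ _ _)) => [ia|]; rewrite ?andbF // andbT.
rewrite ltnNge; apply/negP => le_p.
have lt_r : r < N by apply: leq_ltn_trans (ltn_ord (p (inord i))).
move: le_i; rewrite leqNgt ltn_rowlength // lt_i /= => /negP; apply.
move/same_classP: sc => [/(_ _ ia) + _]; apply: copyNE_mono => //.
by rewrite inordK.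
Qed.

Lemma class_cut p : same_class tau p0 p ->
  (forall r, r <= N -> cut_cond incol link (rowlength r) (prevlength r)
    (tab N (rowword p r))) <-> linked_valleys p.
Proof.
move=> sc.
have pl r : prevlength r <= N by case: r => //= r; apply: rowlength_leq.
have isS r i : i < N -> isSome (nth None (tab N (rowword p r)) i) = (i \in rowword p r).
  move=> lt_i; have := nth_tab_None (rowword p r) lt_i.
  rewrite (set_nth_default None) ?size_tab // => Hn; apply: negb_inj; rewrite -Hn.
  by case: (nth _ _ _).
have adj r i : r <= N -> i.+1 < N -> rowlength r <= i -> link i ->
    (odflt 0 (nth None (tab N (rowword p r)) i.+1) <= odflt 0 (nth None (tab N (rowword p r)) i))
    = (p (inord i) < p (inord i.+1)).
  move=> le_r lt_i le_i /link_incol/andP[c1 c2].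
  have m1 : i \in rowword p r by rewrite class_incol // ltnW.
  have m2 : i.+1 \in rowword p r by rewrite class_incol // ltnW.
  have [u [v [-> -> /= ->]]] := tab_adjacent (uniq_rowword _ _ p le_r) (all_rowword _ _ p r) m1 m2.
  rewrite -(@index_rowword _ _ tau p0 p r (inord i) (inord i.+1)) ?inordK // ltnW //.
split=> [H i l1 l2 lt_p|LV r le_r].
  have lt_i : i.+2 < N by case/and3P: l2 => _ /andP[].
  have [r [le_r le_i lt_pr]] := stage_exist (ltnW (ltnW lt_i)).
  have [_ C] := H r le_r.
  have lt_pr2 : i.+2 < prevlength r.
    case: r le_r le_i lt_pr {C} => [//|r] le_r le_i /=.
    by rewrite (link_rowlength _ l1) (link_rowlength _ l2).
  have := C i le_i lt_pr2 l1 l2.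
  by rewrite !adj ?(leqW le_i) ?(ltnW lt_i) //; apply.
split=> [i /andP[le_i lt_i]|i le_i lt_i l1 l2].
  have lt_N : i < N by apply: leq_trans lt_i (pl r).
  by rewrite isS // class_incol.
have lt_N : i.+2 < N by apply: leq_trans lt_i (pl r).
by rewrite !adj ?(leqW le_i) ?(ltnW lt_N) //; apply: LV.
Qed.

(** The bounds on the letters say that [p] is in the class, the tests of [good] after the inside
    rows say that no chain has appeared, and the cuts say that linked runs have no inner peak. *)
Lemma run_class ops b p : accepts ops ->
  run (@good N k.+1 b) ops (column_word p) (nseq N None) <->
  [/\ same_class tau p0 p, ~~ contains p (dsum (pattern k b) tau) & linked_valleys p].
Proof.
move=> acc; rewrite acc -[in_word _ _]/(rowword p).
have row r : r < N -> row_cond (@good N k.+1 b) inrow rowlength (column p0) (column p) r =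
   (if inrow r then column p r < rowlength r else column p r == column p0 r) &&
   (inrow r ==> ~~ `[< has_chain (chain_rel b) k.+1 (rowword p r.+1) (fun x => x < rowlength r) >]).
  move=> lt_r; rewrite /row_cond; case: ifP => ir; last by rewrite andbT.
  congr (_ && _); rewrite nth_tab_None ?column_lt // -/(rowword p r) -/(rowword p r.+1).
  have -> : column p r \notin rowword p r.
    by rewrite mem_rowword ?column_lt ?(ltnW lt_r) // columnK // ltnn.
  have uw := uniq_rowword tau p0 p lt_r; have aw := all_rowword tau p0 p r.+1.
  have le_c : rowlength r <= N by apply: rowlength_leq.
  rewrite implyTb good_shape //; first last.
  - by rewrite size_takel ?size_tab.
  - exact/lattice_take/lattice_tab.
  rewrite ltnNge; congr (~~ _); apply/idP/asboolP; case: b => /= H.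
  (* [dec_chainP] bounds letters only from below; the upper bound [rowlength r] comes from filtering
     the word. *)
  - move: H; rewrite take_tab // -[tab _ _]drop0 => /dec_chainP[].
    + by rewrite filter_uniq.
    + by rewrite all_filter; apply/allP => x _; apply/implyP.
    by move=> s [+ so sz _]; rewrite subseq_filter => /andP[al sub]; exists s.
  - exact/(inc_chainP _ _ uw aw).
  - rewrite take_tab // -[tab _ _]drop0; apply/dec_chainP.
    + by rewrite filter_uniq.
    + by rewrite all_filter; apply/allP => x _; apply/implyP.
    case: H => s [sub so sz al]; exists s; split=> //; last exact/allP.
    by rewrite subseq_filter al.
  - exact/(inc_chainP _ _ uw aw).
split=> [[HR HC]|[sc nc LV]].
  have sc : same_class tau p0 p.
    by apply/same_class_rows => r lt_r; have := HR r lt_r; rewrite row // => /andP[].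
  split=> //; last exact/(class_cut sc).
  apply/negP => /(contains_chain _ _ sc)[r [lt_r ir ch]].
  by have := HR r lt_r; rewrite row // ir => /andP[_ /negP[]]; apply/asboolP.
split; last exact/(class_cut sc).
move=> r lt_r; rewrite row //; apply/andP; split; first by move/same_class_rows: sc; apply.
apply/implyP => ir; apply/negP => /asboolP ch; case/negP: nc.
by apply/(contains_chain _ _ sc); exists r.
Qed.

Lemma column_word_surj ops (gd : pred {set 'I_N * 'I_N}) v : accepts ops -> count is_letter ops = N ->
  run gd ops v (nseq N None) -> exists p, column_word p = v.
Proof.
move=> acc cl rv; pose x := nth 0 v.
have szv : size v = N by rewrite (size_run rv).
have Ev : v = [seq x r | r <- iota 0 N] by rewrite -szv -[RHS]/(mkseq x (size v)) mkseq_nth.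
move: rv; rewrite {1}Ev => /acc[HR HC].
have x_lt r : r < N -> x r < N.
  move=> lt_r; have := HR r lt_r; rewrite /row_cond; case: ifP => _.
    by case/and3P => lt_x _ _; apply: leq_trans lt_x (rowlength_leq _ _ _).
  by move/eqP->; apply: column_lt.
have in_out r r' : r < N -> r' < N -> inrow r -> ~~ inrow r' -> x r <> x r'.
  move=> lt_r lt_r' ir ir' e.
  have := HR r' lt_r'; rewrite /row_cond (negPf ir') => /eqP e'.
  have := HR r lt_r; rewrite /row_cond ir => /and3P[lt_x _ _].
  have [s [le_s le_xs lt_xs]] := stage_exist (x_lt r lt_r).
  have [+ _] := HC s le_s => /(_ (x r)); rewrite le_xs lt_xs => /(_ isT).
  have -> : incol (x r) = false.
    apply/negbTE/negP => /andP[_]; rewrite e e' /column inord_val.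
    by move=> io; rewrite /inrow io in ir'.
  have mem : x r \in in_word inrow x s.
    apply: map_f; rewrite mem_filter ir mem_iota /= add0n ltnNge; apply/negP => le_sr.
    by have := leq_trans lt_x (rowlength_anti tau p0 le_sr); rewrite ltnNge le_xs.
  have := nth_tab_None (in_word inrow x s) (x_lt r lt_r); rewrite mem.
  by rewrite (set_nth_default None) ?size_tab ?x_lt //; case: (nth _ _ _).
have in_in r r' : r < r' -> r' < N -> inrow r -> inrow r' -> x r <> x r'.
  move=> lt_rr lt_r' ir ir' e.
  have := HR r' lt_r'; rewrite /row_cond ir' nth_tab_None ?x_lt // => /and3P[_ /negP[]].
  by rewrite -e; apply: map_f; rewrite mem_filter ir mem_iota.
have x_inj r r' : r < N -> r' < N -> x r = x r' -> r = r'.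
  move=> lt_r lt_r' e; have [ir|ir] := boolP (inrow r); have [ir'|ir'] := boolP (inrow r').
  - by case: (ltngtP r r') => // lt_rr; [case: (in_in r r') | case: (in_in r' r)].
  - by case: (in_out r r').
  - by case: (in_out r' r).
  have := HR r lt_r; have := HR r' lt_r'; rewrite /row_cond (negPf ir) (negPf ir') -e.
  by move=> /eqP -> /eqP /column_inj ->.
have f_inj : injective (fun r : 'I_N => inord (x r) : 'I_N).
  move=> r r' /(congr1 val); rewrite /= !inordK ?x_lt // => /x_inj e.
  by apply: ord_inj; apply: e.
exists (perm f_inj)^-1%g; rewrite Ev; apply/eq_in_map => r.
rewrite mem_iota /= add0n => lt_r.
by rewrite /column invgK permE inordK ?inordK ?x_lt.
Qed.

Lemma column_word_inj : injective column_word.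
Proof.
move=> p q e; apply: invg_inj; apply/permP => r; apply: ord_inj.
have := congr1 (fun s => nth 0 s r) e.
rewrite !(nth_map 0) ?size_iota ?ltn_ord // !nth_iota ?ltn_ord // !add0n.
by rewrite /column inord_val.
Qed.

Lemma card_run ops (gd : pred {set 'I_N * 'I_N}) : accepts ops -> count is_letter ops = N ->
  #|[set p | run gd ops (column_word p) (nseq N None)]| = size (acc gd ops (nseq N None)).
Proof.
move=> ac cl; rewrite cardE -(size_map column_word).
apply/perm_size/uniq_perm; rewrite ?(map_inj_uniq column_word_inj) ?enum_uniq ?uniq_acc // => v.
rewrite mem_acc; apply/mapP/idP => [[p + ->]|rv]; first by rewrite mem_enum inE.
have [p Ep] := column_word_surj ac cl rv; exists p => //.
by rewrite mem_enum inE Ep.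
Qed.

Lemma card_class :
  #|[set p | [&& same_class tau p0 p, ~~ contains p (dsum (pattern k true) tau)
     & `[< linked_valleys p >]]]| =
  #|[set p | [&& same_class tau p0 p, ~~ contains p (dsum (pattern k false) tau)
     & `[< linked_valleys p >]]]|.
Proof.
have [ops [wo so lo ac]] := @ops_exist N inrow incol link rowlength (column p0)
  (rowlength_leq _ _ _) (rowlengthS _ _) (rowlength0 _ _) link_incol.
have H b : #|[set p | [&& same_class tau p0 p, ~~ contains p (dsum (pattern k b) tau)
     & `[< linked_valleys p >]]]| = size (acc (@good N k.+1 b) ops (nseq N None)).
  rewrite -card_run //; apply: eq_card => p; rewrite !inE.
  apply/and3P/idP => [[sc nc /asboolP LV]|/(run_class b p ac)[sc nc LV]].
    exact/(run_class b p ac).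
  by split=> //; apply/asboolP.
rewrite !H; apply: card_acc_transpose => // nu _; exact: good_transpose.
Qed.

End Class.

(** * Peak sets *)

Section Peaks.
Variables (n : nat).
Notation N := n.+1.
Implicit Types (p : 'S_N) (E X Y : {set 'I_N}).

Definition pred_ord (a : 'I_N) : 'I_N := inord a.-1.

Definition peaks p : {set 'I_N} := [set a : 'I_N |
  [&& 0 < a, a.+1 < N, p (pred_ord a) < p a & p (inord a.+1) < p a]].

(* The peaks allowed by [E] are the elements of [E] and their successors. *)
Definition covered E X := [forall a, (a \in X) ==> (a \in E) || (pred_ord a \in E)].

Lemma coveredP E X : reflect (forall a, a \in X -> (a \in E) || (pred_ord a \in E)) (covered E X).
Proof.
apply: (iffP forallP) => H a; first by move/implyP: (H a).
by apply/implyP/H.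
Qed.

Lemma pred_ordE (a : 'I_N) : pred_ord a = a.-1 :> nat.
Proof. by rewrite /pred_ord inordK // (leq_ltn_trans (leq_pred _)). Qed.

Section Class.
Variables (m k : nat) (tau : 'S_m).

(** Next to an outside point, an inside neighbour is smaller throughout the class and an outside one
    is fixed, so peaks at outside points are those of [p0]. A peak at an inside point has both
    neighbours inside, and is then forbidden exactly when both links are present. *)
Lemma covered_class p0 p E : same_class tau p0 p ->
  covered E (peaks p) <->
  (forall a, a \in peaks p0 -> ~~ inside tau p0 a -> (a \in E) || (pred_ord a \in E)) /\
  linked_valleys tau p0 E p.
Proof.
move=> sc; have [_ out] := same_classP _ _ _ sc.
have insE a : inside tau p a = inside tau p0 a by apply: same_class_inside.
have sc0 : same_class tau p0 p0 by apply/same_classP.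
have nbl q (a : 'I_N) : same_class tau p0 q -> 0 < a -> ~~ inside tau p0 a -> inside tau p0 (pred_ord a) ->
    q (pred_ord a) < q a.
  move=> scq a0 oa ib; apply: (@inside_outside _ _ tau).
  - by rewrite pred_ordE prednK.
  - by rewrite (same_class_inside _ scq).
  - by rewrite (same_class_inside _ scq).
have nbr q (a : 'I_N) : same_class tau p0 q -> a.+1 < N -> ~~ inside tau p0 a -> inside tau p0 (inord a.+1) ->
    q (inord a.+1) < q a.
  move=> scq a0 oa ib; apply: (@outside_inside _ _ tau).
  - by rewrite inordK.
  - by rewrite (same_class_inside _ scq).
  - by rewrite (same_class_inside _ scq).
have pk_out a : ~~ inside tau p0 a -> (a \in peaks p) = (a \in peaks p0).
  move=> oa; rewrite !inE; case: (posnP a) => //= a0; case: ltnP => //= lt_a.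
  congr (_ && _).
    have [ib|ob] := boolP (inside tau p0 (pred_ord a)); first by rewrite !nbl.
    by rewrite !out.
  have [ib|ob] := boolP (inside tau p0 (inord a.+1)); first by rewrite !nbr.
  by rewrite !out.
split=> [/coveredP cov|[fx LV]].
  split=> [a ap oa|i l1 l2 lt_p]; first by apply: cov; rewrite pk_out.
  have /and3P[_ /andP[lt_i1 _] nE1] := l1; have /and3P[_ /andP[lt_i2 _] nE2] := l2.
  have Ep : pred_ord (inord i.+1) = inord i :> 'I_N.
    by apply: ord_inj; rewrite pred_ordE !inordK // ltnW.
  rewrite ltnNge leq_eqVlt; apply/negP => /orP[/eqP/ord_inj/perm_inj e|lt_p2].
    by have := congr1 (@nat_of_ord N) e; rewrite !inordK //; lia.
  have := cov (inord i.+1); rewrite !inE Ep inordK //= lt_i2 lt_p lt_p2 => /(_ isT).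
  by rewrite (negPf nE1) (negPf nE2).
apply/coveredP => a ap; have [ia|oa] := boolP (inside tau p0 a); last first.
  by apply: fx => //; rewrite -pk_out.
move: (ap); rewrite inE => /and4P[a0 lt_a lt_l lt_r].
rewrite -[_ || _]negbK negb_or; apply/negP => /andP[nE1 nE2].
have ib : inside tau p0 (pred_ord a).
  apply: contraT => ob; have := @outside_inside _ _ tau p (pred_ord a) a.
  by rewrite !insE ob ia pred_ordE prednK // ltnNge (ltnW lt_l) => /(_ erefl isT isT).
have ic : inside tau p0 (inord a.+1).
  apply: contraT => ob; have := @inside_outside _ _ tau p a (inord a.+1).
  by rewrite !insE ob ia inordK // ltnNge (ltnW lt_r) => /(_ erefl isT isT).
have aK : a.-1.+1 = a by rewrite prednK.
have Epa : inord a.-1 = pred_ord a by [].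
have l1 : link tau p0 E a.-1.
  by rewrite /link /incol aK inord_val Epa ib ia nE2 ltn_ord ltnW.
have l2 : link tau p0 E a.-1.+1 by rewrite aK /link /incol inord_val ia ic nE1 lt_a ltn_ord.
have := LV _ l1 l2; rewrite aK inord_val Epa => /(_ lt_l).
by rewrite ltnNge (ltnW lt_r).
Qed.

Lemma card_covered E :
  #|[set p | ~~ contains p (dsum (pattern k true) tau) && covered E (peaks p)]| =
  #|[set p | ~~ contains p (dsum (pattern k false) tau) && covered E (peaks p)]|.
Proof.
pose A b key := [set p | [&& ~~ contains p (dsum (pattern k b) tau), covered E (peaks p)
   & class_key tau p == key]].
have split b : #|[set p | ~~ contains p (dsum (pattern k b) tau) && covered E (peaks p)]| =
    \sum_key #|A b key|.
  rewrite -sum1_card (partition_big (class_key tau) predT) //=.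
  apply: eq_bigr => key _; rewrite -sum1_card; apply: eq_bigl => p.
  by rewrite !inE andbA.
rewrite !split; apply: eq_bigr => key _.
have [/existsP[p0 /eqP Ek]|] := boolP [exists p0, class_key tau p0 == key]; last first.
  rewrite negb_exists => /forallP no.
  have A0 b : A b key = set0.
    by apply/setP => p; rewrite !inE (negPf (no p)) !andbF.
  by rewrite !A0.
have [fx|nfx] := pselect (forall a, a \in peaks p0 -> ~~ inside tau p0 a ->
    (a \in E) || (pred_ord a \in E)); last first.
  have A0 b : A b key = set0.
    apply/setP => p; rewrite !inE -Ek class_keyP; apply/negP => /and3P[_ cov sc].
    by apply: nfx; have [] := (covered_class E sc).1 cov.
  by rewrite !A0.
have AE b : A b key = [set p | [&& same_class tau p0 p, ~~ contains p (dsum (pattern k b) tau)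
     & `[< linked_valleys tau p0 E p >]]].
  apply/setP => p; rewrite !inE -Ek class_keyP; apply/and3P/and3P.
    move=> [nc cov sc]; split=> //; apply/asboolP.
    by have [] := (covered_class E sc).1 cov.
  by move=> [sc nc /asboolP LV]; split=> //; apply/(covered_class E sc).
by rewrite !AE card_class.
Qed.

End Class.

Definition sparse X := forall a, a \in X -> 0 < a /\ pred_ord a \notin X.

Lemma sparse_peaks p : sparse (peaks p).
Proof.
move=> a; rewrite !inE => /and4P[a0 lt_a lt_l lt_r]; split=> //.
rewrite pred_ordE prednK // inord_val !negb_and -leqNgt -[~~ (p a < _)]leqNgt.
by rewrite (ltnW lt_l) !orbT.
Qed.

Definition weight X := \sum_(a in X) (N - a).

(** Each element of [Y :\: X] has its predecessor in [X] by covering, and outside [Y] by sparseness.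
    Passing to predecessors raises the weight by one per element. *)
Lemma weight_covered X Y : sparse Y -> covered X Y -> Y != X -> weight Y < weight X.
Proof.
move=> spY /coveredP cov ne.
have wD (Z T : {set 'I_N}) : weight Z = weight (Z :&: T) + weight (Z :\: T).
  by rewrite /weight (big_setID T).
rewrite (wD Y X) (wD X Y) setIC ltn_add2l.
have sub : [set pred_ord a | a in Y :\: X] \subset X :\: Y.
  apply/subsetP => _ /imsetP[a aYX ->]; move: aYX; rewrite !in_setD => /andP[naX aY].
  have [_ ->] := spY a aY; rewrite /=.
  by have := cov a aY; rewrite (negPf naX).
have inj : {in Y :\: X &, injective pred_ord}.
  move=> a b; rewrite !in_setD => /andP[_ /spY[a0 _]] /andP[_ /spY[b0 _]].
  move/(congr1 (@nat_of_ord N)); rewrite !pred_ordE => e.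
  by apply: ord_inj; rewrite -(prednK a0) -(prednK b0) e.
have le1 : weight (Y :\: X) + #|Y :\: X| <= weight (X :\: Y).
  have -> : weight (X :\: Y) = weight [set pred_ord a | a in Y :\: X] +
      weight ((X :\: Y) :\: [set pred_ord a | a in Y :\: X]).
    by rewrite (wD (X :\: Y) [set pred_ord a | a in Y :\: X]) (setIidPr sub).
  apply: leq_trans (leq_addr _ _); rewrite /weight big_imset //= -sum1_card -big_split /=.
  apply: leq_sum => a; rewrite in_setD => /andP[_ /spY[a0 _]]; rewrite pred_ordE.
  by have := ltn_ord a; lia.
have [Y0|Yn0] := posnP #|Y :\: X|; last by lia.
have {}Y0 : Y :\: X = set0 by apply/eqP; rewrite -cards_eq0 Y0.
rewrite Y0 {1}/weight big_set0.
have /set0Pn[a aXY] : X :\: Y != set0.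
  apply: contra ne => /eqP X0; rewrite eqEsubset -!setD_eq0 Y0 X0.
  by rewrite eqxx.
by rewrite /weight (bigD1 a) //= addn_gt0 subn_gt0 ltn_ord.
Qed.

(** Induction on the weight: among the peak sets covered by [X], all except [X] itself are lighter,
    so their contributions cancel from the equality for covered sets. *)
Lemma card_peaks m k (tau : 'S_m) X :
  #|[set p | ~~ contains p (dsum (pattern k true) tau) && (peaks p == X)]| =
  #|[set p | ~~ contains p (dsum (pattern k false) tau) && (peaks p == X)]|.
Proof.
pose A b X := [set p | ~~ contains p (dsum (pattern k b) tau) && (peaks p == X)].
have [d] := ubnP (weight X); elim: d X => // d IH X lt_d.
have [spX|nspX] := pselect (sparse X); last first.
  have A0 b : A b X = set0.
    apply/setP => p; rewrite !inE; apply/negP => /andP[_ /eqP e].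
    by apply: nspX; rewrite -e; apply: sparse_peaks.
  by rewrite -!/(A _ _) !A0.
have split b : #|[set p | ~~ contains p (dsum (pattern k b) tau) && covered X (peaks p)]| =
    #|A b X| + \sum_(Y | covered X Y && (Y != X)) #|A b Y|.
  rewrite -sum1_card (partition_big peaks (covered X)) /=; last first.
    by move=> p; rewrite inE => /andP[].
  rewrite (bigD1 X) /=; last by apply/coveredP => a ->.
  have AE Y : covered X Y ->
      \sum_(p in [set p | ~~ contains p (dsum (pattern k b) tau) && covered X (peaks p)]
         | peaks p == Y) 1 = #|A b Y|.
    move=> cY; rewrite -sum1_card; apply: eq_bigl => p; rewrite !inE -andbA.
    by congr (_ && _); case: eqP => [->|]; rewrite ?cY ?andbF.
  rewrite AE; last by apply/coveredP => a ->.
  by congr (_ + _); apply: eq_bigr => Y /andP[cY _]; apply: AE.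
have := card_covered k tau X; rewrite !split.
suff -> : \sum_(Y | covered X Y && (Y != X)) #|A true Y| =
          \sum_(Y | covered X Y && (Y != X)) #|A false Y| by move/addIn.
apply: eq_bigr => Y /andP[cY ne].
have [spY|nspY] := pselect (sparse Y).
  by apply: IH; apply: leq_trans (weight_covered spY cY ne) _; rewrite -ltnS.
have A0 b : A b Y = set0.
  apply/setP => p; rewrite !inE; apply/negP => /andP[_ /eqP e].
  by apply: nspY; rewrite -e; apply: sparse_peaks.
by rewrite !A0.
Qed.

(** * Translation to one-line notation *)

Lemma letterE p (a : 'I_N) : letter p a.+1 = (p a).+1.
Proof.
rewrite /letter /Defs.word /image_mem (nth_map a) ?size_enum_ord //=.
by rewrite nth_ord_enum.
Qed.

Lemma mem_peak p i : peak p i <-> exists2 a, a \in peaks p & i = a.+1.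
Proof.
split=> [[i2 iN l1 l2]|[a]].
  have lt_i : i.-1 < N by lia.
  have E : i = (Ordinal lt_i).+1 by rewrite /= prednK // ltnW.
  exists (Ordinal lt_i) => //; set a := Ordinal lt_i in E *.
  have lt_a : a.+1 < N by lia.
  have a0 : 0 < a by lia.
  have E1 : i - 1 = (pred_ord a).+1 by rewrite pred_ordE; lia.
  have E2 : i + 1 = (inord a.+1 : 'I_N).+1 by rewrite inordK; lia.
  by move: l1 l2; rewrite E1 E2 E !letterE inE a0 lt_a !ltnS => -> ->.
rewrite inE => /and4P[a0 lt_a lt_l lt_r] ->.
have E1 : a.+1 - 1 = (pred_ord a).+1 by rewrite pred_ordE; lia.
have E2 : a.+1 + 1 = (inord a.+1 : 'I_N).+1 by rewrite inordK // addn1.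
by split; [lia | lia | rewrite E1 !letterE | rewrite E2 !letterE].
Qed.

Lemma eq_peak p q : (peak p = peak q) <-> (peaks p = peaks q).
Proof.
split=> e; last first.
  apply/funext => i; apply/propext.
  by rewrite !mem_peak e.
have sub (p1 q1 : 'S_N) : peak p1 = peak q1 -> peaks p1 \subset peaks q1.
  move=> e1; apply/subsetP => a ap.
  have : peak p1 a.+1 by apply/mem_peak; exists a.
  by rewrite e1 => /mem_peak[b bq [/ord_inj ->]].
by apply/eqP; rewrite eqEsubset !sub.
Qed.

End Peaks.

From mathcomp Require Import classical_sets.

Theorem corollary1p4 (n k : nat) (n_ge1 : 1 <= n) (k_ge1 : 1 <= k)
    (m : nat) (tau : 'S_m)
    (A : set nat) (A_pos : forall i : nat, A i -> 1 <= i) :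
  #|[set pi in avoiders n (dsum (incr_perm k) tau) | `[< peak pi = A >]]%SET|
  = #|[set pi in avoiders n (dsum (decr_perm k) tau) | `[< peak pi = A >]]%SET|.
Proof.
case: n n_ge1 => // n _; case: k k_ge1 => // k _.
(* If [A] is no peak set both counts vanish; otherwise [A] can be replaced by the finite set
   [peaks q]. *)
have [[q Eq]|no] := pselect (exists q : 'S_n.+1, peak q = A); last first.
  have none b : [set pi in avoiders n.+1 (dsum (pattern k b) tau) | `[< peak pi = A >]]%SET = finset.set0.
    apply/finset.setP => p; rewrite !inE; apply/negP => /andP[_ /asboolP e].
    by apply: no; exists p.
  by rewrite (none false) (none true).
have AE b : #|[set pi in avoiders n.+1 (dsum (pattern k b) tau) | `[< peak pi = A >]]%SET| =
    #|[set p | ~~ contains p (dsum (pattern k b) tau) && (peaks p == peaks q)]%SET|.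
  apply: eq_card => p; rewrite !inE; congr (_ && _).
  by apply/asboolP/eqP; rewrite -Eq => /eq_peak.
by rewrite (AE false) (AE true) card_peaks.
Qed.
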